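(* Let $\mathbb{G}$ be a compact quantum group, $\alpha\in\operatorname{Irr}(\mathbb{G})$ and $\theta(\alpha)\in[0,1]$. Then the representation $$v^{\alpha}_{\theta(\alpha)}=\left(1\otimes Q_{\alpha}^{\frac{\theta(\alpha)}{2}}\right)(u^{\alpha})^c\left(1\otimes Q_{\alpha}^{-\frac{\theta(\alpha)}{2}}\right)\in L^{\infty}(\mathbb{G})\otimes M_{n_{\alpha}}$$ satisfies $\|v^{\alpha}_{\theta(\alpha)}\|_{L^{\infty}(\mathbb{G})\overline{\otimes}M_{n_{\alpha}}}\leq n_{\alpha}^{1-\theta(\alpha)}$.
   Context: A compact quantum group $\mathbb{G}=(L^\infty(\mathbb{G}),\Delta,h)$ (von Neumann algebraic setting) is a von Neumann algebra $L^\infty(\mathbb{G})$ with a coassociative normal unital $*$-homomorphism $\Delta:L^\infty(\mathbb{G})\to L^\infty(\mathbb{G})\overline{\otimes}L^\infty(\mathbb{G})$ and a faithful normal state $h$ (the Haar state) with $(\operatorname{id}\otimes h)\Delta(a)=h(a)1=(h\otimes\operatorname{id})\Delta(a)$. A representation of $\mathbb{G}$ on a Hilbert space $H_V$ is an element $V\in L^\infty(\mathbb{G})\overline{\otimes}B(H_V)$ with $(\Delta\otimes\operatorname{id})(V)=V_{13}V_{23}$. $\operatorname{Irr}(\mathbb{G})$ is the set of equivalence classes of irreducible unitary representations; for $\alpha\in\operatorname{Irr}(\mathbb{G})$ fix a representative $u^\alpha=\sum_{i,j=1}^{n_\alpha}u^\alpha_{ij}\otimes e^\alpha_{ij}\in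 L^\infty(\mathbb{G})\otimes B(H_\alpha)$, $n_\alpha=\dim H_\alpha$, $B(H_\alpha)\cong M_{n_\alpha}$. With the antipode $S(u^\alpha_{ij})=(u^\alpha_{ji})^*$ on $\operatorname{Pol}(\mathbb{G})=\operatorname{span}\{u^\alpha_{ij}\}$, $Q_\alpha\in B(H_\alpha)$ is the unique positive invertible operator with $\operatorname{Tr}(Q_\alpha)=\operatorname{Tr}(Q_\alpha^{-1})$ and $(S^2\otimes\operatorname{id})(u^\alpha)=(1\otimes Q_\alpha)u^\alpha(1\otimes Q_\alpha^{-1})$. The orthonormal basis of $H_\alpha$ defining the matrix units $e^\alpha_{ij}$ is chosen so that $Q_\alpha$ is diagonal. The contragredient representation is $(u^\alpha)^c=\sum_{i,j}(u^\alpha_{ij})^*\otimes e^\alpha_{ij}$ with respect to this basis; $(1\otimes Q_\alpha^{1/2})(u^\alpha)^c(1\otimes Q_\alpha^{-1/2})$ is unitary. *)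

(* Defs.v *)
From HB Require Import structures.
From mathcomp Require Import all_boot all_order all_algebra.
From mathcomp Require Import complex spectral.
From mathcomp Require Import all_classical all_reals all_analysis.

Set Implicit Arguments.
Unset Strict Implicit.
Unset Printing Implicit Defensive.

Import Order.TTheory GRing.Theory Num.Theory.
Import numFieldNormedType.Exports.

Local Open Scope classical_set_scope.
Local Open Scope complex_scope.
Local Open Scope sesquilinear_scope.
Local Open Scope ring_scope.

(* The norm of a normedModType over R[i] is R[i]-valued (with values in the
   nonnegative reals).  The inner product is linear in its first argument. *)
HB.mixin Record CompleteNormedModule_isHilbert (R : realType) H
    of CompleteNormedModule R[i] H := {
  inner : H -> H -> R[i] ;
  inner_linearl : forall y, linear (fun x => inner x y : R[i]^o) ;
  innerC : forall x y, inner y x = (inner x y)^* ;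
  inner_norm : forall x, inner x x = `|x| ^+ 2
}.

#[short(type="hilbertType")]
HB.structure Definition Hilbert (R : realType) :=
  { H of CompleteNormedModule_isHilbert R H & CompleteNormedModule R[i] H }.

Section Operators.
Context {R : realType}.
Implicit Types H K L : hilbertType R.

(* Operators are represented as functions; the bounded ones are singled out
   by this predicate. *)
Definition bounded_op H K (a : H -> K) : Prop := linear a /\ continuous a.

Definition is_adjoint H K (a : H -> K) (b : K -> H) : Prop :=
  forall x y, inner (a x) y = inner x (b y).

(* The adjoint; every bounded operator has exactly one.  The default value is
   irrelevant for bounded operators. *)
Definition adjoint H (a : H -> H) : H -> H := xget (fun=> 0) (is_adjoint a).

Definition self_adjoint H (a : H -> H) : Prop := is_adjoint a a.

Definition positive_op H (a : H -> H) : Prop := forall x, 0 <= inner (a x) x.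

Definition op_le H (a b : H -> H) : Prop := positive_op (b - a).

Definition commutant H (A : set (H -> H)) : set (H -> H) :=
  [set a | bounded_op a /\ forall b, A b -> a \o b = b \o a].

Definition von_neumann_algebra H (M : set (H -> H)) : Prop :=
  (forall a, M a -> exists2 b, M b & is_adjoint a b) /\
  commutant (commutant M) = M.

Definition selfadj_part H (M : set (H -> H)) : set (H -> H) :=
  M `&` [set a | self_adjoint a].

(* s is the least upper bound of D inside A, for the relation le. *)
Definition lub_in T (le : T -> T -> Prop) (A D : set T) (s : T) : Prop :=
  [/\ A s, forall d, D d -> le d s
    & forall t, A t -> (forall d, D d -> le d t) -> le s t].

Definition directed T (le : T -> T -> Prop) (D : set T) : Prop :=
  forall a b, D a -> D b -> exists c, [/\ D c, le a c & le b c].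

(* Normality of a positive map: it preserves the suprema of upward directed
   families of self-adjoint elements. *)
Definition preserves_sup H T (M : set (H -> H)) (le : T -> T -> Prop)
    (B : set T) (Phi : (H -> H) -> T) : Prop :=
  forall (D : set (H -> H)) (s : H -> H),
    D !=set0 -> D `<=` selfadj_part M -> directed (@op_le H) D ->
    lub_in (@op_le H) (selfadj_part M) D s ->
    lub_in le B (Phi @` D) (Phi s).

(* Maps between algebras are total functions on operators, of which only the
   restriction to M is meaningful. *)
Definition linear_on H (V : lmodType R[i]) (M : set (H -> H))
    (Phi : (H -> H) -> V) : Prop :=
  forall (c : R[i]) a b, M a -> M b -> Phi (c *: a + b) = c *: Phi a + Phi b.

Definition normal_positive_map H K (M : set (H -> H)) (N : set (K -> K))
    (Phi : (H -> H) -> (K -> K)) : Prop :=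
  [/\ forall a, M a -> N (Phi a),
      linear_on M Phi,
      forall a, M a -> positive_op a -> positive_op (Phi a)
    & preserves_sup M (@op_le K) (selfadj_part N) Phi].

Definition normal_unital_star_hom H K (M : set (H -> H)) (N : set (K -> K))
    (Phi : (H -> H) -> (K -> K)) : Prop :=
  [/\ normal_positive_map M N Phi,
      forall a b, M a -> M b -> Phi (a \o b) = Phi a \o Phi b,
      forall a b, M a -> M b -> is_adjoint a b -> is_adjoint (Phi a) (Phi b)
    & Phi idfun = idfun].

Definition faithful_normal_state H (M : set (H -> H))
    (h : (H -> H) -> R[i]) : Prop :=
  [/\ linear_on M (h : (H -> H) -> R[i]^o),
      forall a, M a -> positive_op a -> 0 <= h a,
      h idfun = 1,
      forall a, M a -> positive_op a -> h a = 0 -> a = (fun=> 0)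
    & preserves_sup M (fun x y : R[i] => x <= y) setT h].

(* t exhibits L as the Hilbert space tensor product of H and K; this
   determines (L, t) up to a unique unitary isomorphism. *)
Definition hilbert_tensor H K L (t : H -> K -> L) : Prop :=
  [/\ forall y, linear (t^~ y),
      forall x, linear (t x),
      forall x x' y y', inner (t x y) (t x' y') = inner x x' * inner y y'
    & dense [set z | exists n (x : 'I_n -> H) (y : 'I_n -> K),
                       z = \sum_(i < n) t (x i) (y i)]].

(* The operator a (x) b on L; for a and b bounded there is exactly one such
   bounded operator. *)
Definition tensor_op H K L (t : H -> K -> L) (a : H -> H) (b : K -> K) :
    L -> L :=
  xget (fun=> 0)
    [set c | bounded_op c /\ forall x y, c (t x y) = t (a x) (b y)].

Definition vn_tensor H K L (t : H -> K -> L) (M : set (H -> H))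
    (N : set (K -> K)) : set (L -> L) :=
  commutant (commutant [set tensor_op t a b | a in M & b in N]).

(* A von Neumann algebra is given by a realization on a Hilbert space qgH.
   qgHH is a model of qgH (x) qgH, and qgHHH one of the triple tensor product,
   presented both as qgHH (x) qgH and as qgH (x) qgHH.  The maps
   comul (x) id, id (x) comul, id (x) haar and haar (x) id are the unique
   normal extensions from the elementary tensors. *)
Record compactQuantumGroup := CompactQuantumGroup {
  qgH : hilbertType R ;
  qgHH : hilbertType R ;
  qgHHH : hilbertType R ;
  tens : qgH -> qgH -> qgHH ;
  tens_l : qgHH -> qgH -> qgHHH ;
  tens_r : qgH -> qgHH -> qgHHH ;
  tensP : hilbert_tensor tens ;
  tens_lP : hilbert_tensor tens_l ;
  tens_rP : hilbert_tensor tens_r ;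
  tensA : forall x y z, tens_l (tens x y) z = tens_r x (tens y z) ;
  Linf : set (qgH -> qgH) ;
  LinfP : von_neumann_algebra Linf ;
  comul : (qgH -> qgH) -> (qgHH -> qgHH) ;
  haar : (qgH -> qgH) -> R[i] ;
  comulP : normal_unital_star_hom Linf (vn_tensor tens Linf Linf) comul ;
  comulA : exists Phi Psi : (qgHH -> qgHH) -> (qgHHH -> qgHHH),
    [/\ normal_unital_star_hom (vn_tensor tens Linf Linf)
          (vn_tensor tens_l (vn_tensor tens Linf Linf) Linf) Phi,
        normal_unital_star_hom (vn_tensor tens Linf Linf)
          (vn_tensor tens_r Linf (vn_tensor tens Linf Linf)) Psi,
        forall a b, Linf a -> Linf b ->
          Phi (tensor_op tens a b) = tensor_op tens_l (comul a) b,
        forall a b, Linf a -> Linf b ->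
          Psi (tensor_op tens a b) = tensor_op tens_r a (comul b)
      & forall a, Linf a -> Phi (comul a) = Psi (comul a)] ;
  haarP : faithful_normal_state Linf haar ;
  haar_invr : exists E : (qgHH -> qgHH) -> (qgH -> qgH),
    [/\ normal_positive_map (vn_tensor tens Linf Linf) Linf E,
        forall a b, Linf a -> Linf b -> E (tensor_op tens a b) = haar b *: a
      & forall a, Linf a -> E (comul a) = haar a *: idfun] ;
  haar_invl : exists E : (qgHH -> qgHH) -> (qgH -> qgH),
    [/\ normal_positive_map (vn_tensor tens Linf Linf) Linf E,
        forall a b, Linf a -> Linf b -> E (tensor_op tens a b) = haar a *: b
      & forall a, Linf a -> E (comul a) = haar a *: idfun]
}.

Definition opmx_mul H n (A B : 'M[H -> H]_n) : 'M[H -> H]_n :=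
  \matrix_(i, j) \sum_k (A i k \o B k j).

Definition opmx_star H n (A : 'M[H -> H]_n) : 'M[H -> H]_n :=
  \matrix_(i, j) adjoint (A j i).

(* 1 (x) X *)
Definition opmx_amp H n (X : 'M[R[i]]_n) : 'M[H -> H]_n :=
  \matrix_(i, j) (X i j *: idfun).

(* The norm of the Hilbert space H (x) C^n = H^n. *)
Definition dsum_norm H n (x : 'I_n -> H) : R :=
  Num.sqrt (\sum_i (complex.Re `|x i|) ^+ 2).

Definition opmx_norm H n (A : 'M[H -> H]_n) : R :=
  sup [set dsum_norm (fun i => \sum_j A i j (x j))
      | x in [set x : 'I_n -> H | dsum_norm x <= 1]].

(* Functional calculus t |-> Q^t for a diagonal matrix Q with positive
   diagonal entries. *)
Definition diag_power n (Q : 'M[R[i]]_n) (t : R) : 'M[R[i]]_n :=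
  diag_mx (\row_i (complex.Re (Q i i) `^ t)%:C).

Definition positive_mx n (Q : 'M[R[i]]_n) : Prop :=
  forall x : 'cV[R[i]]_n, 0 <= (x ^t* *m Q *m x) 0 0.

End Operators.

Arguments compactQuantumGroup R : clear implicits.
Arguments opmx_amp {R} H {n} X.

Section Representations.
Context {R : realType} (G : compactQuantumGroup R).
Local Notation H := (qgH G).
Implicit Types n : nat.

(* (comul (x) id)(v) = v_13 v_23, read off in matrix entries *)
Definition representation n (v : 'M[H -> H]_n) : Prop :=
  (forall i j, Linf (v i j)) /\
  (forall i j,
     comul (v i j) = \sum_k tensor_op (@tens R G) (v i k) (v k j)).

Definition unitary_rep n (v : 'M[H -> H]_n) : Prop :=
  [/\ representation v,
      opmx_mul (opmx_star v) v = opmx_amp H 1%:M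
    & opmx_mul v (opmx_star v) = opmx_amp H 1%:M].

(* No invariant subspaces besides 0 and the whole (nonzero) space; a subspace
   is given by its orthogonal projection p, and it is invariant when
   (1 (x) p) v (1 (x) p) = v (1 (x) p). *)
Definition irreducible n (v : 'M[H -> H]_n) : Prop :=
  (0 < n)%N /\
  forall p : 'M[R[i]]_n, p *m p = p -> p ^t* = p ->
    opmx_mul (opmx_amp H p) (opmx_mul v (opmx_amp H p))
      = opmx_mul v (opmx_amp H p) ->
    p = 0 \/ p = 1%:M.

Definition irreducible_unitary n (v : 'M[H -> H]_n) : Prop :=
  unitary_rep v /\ irreducible v.

(* The span of the coefficients does not depend on the choice of a
   representative in each class of irreducible unitary representations: all
   representatives are used. *)
Definition Pol : set (H -> H) :=
  [set a | exists m (c : 'I_m -> R[i]) (b : 'I_m -> (H -> H)),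
     (forall k, exists n (v : 'M[H -> H]_n) i j,
        irreducible_unitary v /\ b k = v i j) /\
     a = \sum_k c k *: b k].

Definition antipode (S : (H -> H) -> (H -> H)) : Prop :=
  linear_on Pol S /\
  forall n (v : 'M[H -> H]_n), irreducible_unitary v ->
    forall i j, S (v i j) = adjoint (v j i).

(* Q = Q_u; the last condition is (S^2 (x) id)(u) = (1 (x) Q) u (1 (x) Q^-1). *)
Definition modular_mx S n (u : 'M[H -> H]_n) (Q : 'M[R[i]]_n) : Prop :=
  [/\ positive_mx Q, Q \in unitmx, \tr Q = \tr (invmx Q)
    & map_mx (S \o S) u
        = opmx_mul (opmx_amp H Q) (opmx_mul u (opmx_amp H (invmx Q)))].

Definition contragredient n (u : 'M[H -> H]_n) : 'M[H -> H]_n :=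
  map_mx (@adjoint R H) u.

(* (1 (x) Q^(theta/2)) u^c (1 (x) Q^(-theta/2)) *)
Definition twisted_contragredient n (u : 'M[H -> H]_n) (Q : 'M[R[i]]_n)
    (theta : R) : 'M[H -> H]_n :=
  opmx_mul (opmx_amp H (diag_power Q (theta / 2)))
    (opmx_mul (contragredient u)
       (opmx_amp H (diag_power Q (- (theta / 2))))).

End Representations.

(* Main.v *)
Require Import Defs.
From HB Require Import structures.
From mathcomp Require Import all_boot all_order all_algebra.
From mathcomp Require Import complex spectral ring lra.
From mathcomp Require Import all_classical all_reals all_analysis.

Set Implicit Arguments.
Unset Strict Implicit.
Unset Printing Implicit Defensive.

Import Order.TTheory GRing.Theory Num.Theory.
Import numFieldNormedType.Exports.

Local Open Scope classical_set_scope.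
Local Open Scope complex_scope.
Local Open Scope sesquilinear_scope.
Local Open Scope ring_scope.

(** Write V for the contragredient u^c and w_t = Q^(t/2) V Q^(-t/2), so that the
    claim is that w_t is a representation of norm at most n^(1 - t).

    The endpoint t = 1 is where the quantum group enters.  The matrices E
    and F, the images of V* V and of V V* under h (x) id, satisfy V* E V = E and
    V F V* = F by invariance of the Haar state (haar_averagel, haar_averager),
    and both are invertible because h is faithful and u is unitary.  Hence V has
    a two-sided inverse, and W = X V X^-1 with X* X = E is a unitary
    representation (contragredient_unitarizable), irreducible because u is.  The
    coefficients of V are thus combinations of those of an irreducible unitary
    representation, on which the antipode is known; computing S^2 gives
    S^2(u) = E^T u (E^T)^-1.  By Schur's lemma Q is a multiple of E^T, so, Q being
    diagonal, V* Q V = Q (modular_mx_invariant), and w_1 is an isometry.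

    At t = 0 each entry of V is a contraction, so that V has norm at most n
    (norm_le_conj).

    In between one expects Hadamard's three lines theorem.  It is replaced by
    midpoint convexity, |w_t|^2 <= |w_(t+d)| |w_(t-d)| (twist_midpoint): the
    operator w_t* w_t is similar, through a power of Q, to w_(t+d)* w_(t-d), and
    for a positive operator the norm is the spectral radius, i.e. only the growth
    of powers matters (norm_le_similar).  If K is any constant such that
    |w_t| <= K n^(1 - t) on all of [0, 1], midpoint convexity with the nearer
    endpoint replaces K by its square root (twist_improve); iterating, K = 1.

    That V is a representation at all rests on the existence of a (x) b on the
    Hilbert tensor product for bounded a and b (tensor_op_exists): after
    orthogonalizing one leg of an elementary sum the bound for a (x) 1 is
    Pythagoras, and a densely defined bounded operator extends.  Adjoints are
    then compared on simple tensors.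

    Matrices of operators are handled as honest matrices over the *-ring of
    adjointable operators, on which the matrix calculus is available. *)

(** * Inner products and adjoints *)

Section PositiveForm.
Context {C : numClosedFieldType} {V : lmodType C} (f : V -> V -> C).
Hypothesis fl : forall y, linear (fun x => f x y : C^o).
Hypothesis fC : forall x y, f y x = (f x y)^*.
Hypothesis f_ge0 : forall x, 0 <= f x x.
Hypothesis f_eq0 : forall x, f x x = 0 -> x = 0.

Lemma formDl x x' y : f (x + x') y = f x y + f x' y.
Proof. by have := fl y 1 x x'; rewrite !scale1r. Qed.

Lemma form0l y : f 0 y = 0.
Proof. by apply: (addrI (f 0 y)); rewrite -formDl !addr0. Qed.

Lemma formZl c x y : f (c *: x) y = c * f x y.
Proof. by have := fl y c x 0; rewrite /= form0l !addr0. Qed.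

Lemma formDr x y y' : f x (y + y') = f x y + f x y'.
Proof. by rewrite fC formDl rmorphD /= -!fC. Qed.

Lemma formZr c x y : f x (c *: y) = c^* * f x y.
Proof. by rewrite fC formZl rmorphM /= -fC. Qed.

Lemma form0r x : f x 0 = 0.
Proof. by rewrite fC form0l conjC0. Qed.

Lemma form_CauchySchwarz x y : `|f x y| ^+ 2 <= f x x * f y y.
Proof.
have [fy0|fyN0] := eqVneq (f y y) 0.
  by rewrite (f_eq0 fy0) !form0r normr0 expr0n mulr0.
have fy_gt0 : 0 < f y y by rewrite lt_def fyN0 f_ge0.
have fyr : (f y y)^* = f y y by rewrite -fC.
have := f_ge0 (f y y *: x - f x y *: y).
rewrite -scaleN1r !(formDl, formZl, formDr, formZr) fyr !rmorphN1 (fC x y).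
set a := f x y; set b := f y y; set c := f x x => h.
have : 0 <= b * (c * b - `|a| ^+ 2).
  by rewrite normCK; apply: le_trans h _; rewrite le_eqVlt; apply/orP/or_introl/eqP; ring.
by rewrite pmulr_rge0 // subr_ge0.
Qed.

End PositiveForm.

Section Inner.
Context {R : realType}.
Implicit Types H K L : hilbertType R.

Lemma inner_ge0 H (x : H) : 0 <= inner x x.
Proof. by rewrite inner_norm exprn_ge0. Qed.

Lemma inner_eq0 H (x : H) : inner x x = 0 -> x = 0.
Proof. by rewrite inner_norm => /eqP; rewrite expf_eq0 /= normr_eq0 => /eqP. Qed.

Lemma innerDl H (x x' y : H) : inner (x + x') y = inner x y + inner x' y.
Proof. exact: (formDl (@inner_linearl R H)). Qed.
Lemma innerZl H c (x y : H) : inner (c *: x) y = c * inner x y.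
Proof. exact: (formZl (@inner_linearl R H)). Qed.
Lemma inner0l H (y : H) : inner 0 y = 0.
Proof. exact: (form0l (@inner_linearl R H)). Qed.
Lemma innerDr H (x y y' : H) : inner x (y + y') = inner x y + inner x y'.
Proof. exact: (formDr (@inner_linearl R H) (@innerC R H)). Qed.
Lemma innerZr H c (x y : H) : inner x (c *: y) = c^* * inner x y.
Proof. exact: (formZr (@inner_linearl R H) (@innerC R H)). Qed.
Lemma inner0r H (x : H) : inner x 0 = 0.
Proof. exact: (form0r (@inner_linearl R H) (@innerC R H)). Qed.
Lemma innerNl H (x y : H) : inner (- x) y = - inner x y.
Proof. by rewrite -scaleN1r innerZl mulN1r. Qed.
Lemma innerBl H (x x' y : H) : inner (x - x') y = inner x y - inner x' y.
Proof. by rewrite innerDl innerNl. Qed.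
Lemma inner_suml H I r (P : pred I) (F : I -> H) y :
  inner (\sum_(i <- r | P i) F i) y = \sum_(i <- r | P i) inner (F i) y.
Proof. exact: (big_morph (fun x => inner x y) (fun u v => innerDl u v y) (inner0l y)). Qed.
Lemma inner_sumr H I r (P : pred I) (F : I -> H) x :
  inner x (\sum_(i <- r | P i) F i) = \sum_(i <- r | P i) inner x (F i).
Proof. exact: (big_morph (inner x) (innerDr x) (inner0r x)). Qed.

Lemma inner_CauchySchwarz H (x y : H) : `|inner x y| <= `|x| * `|y|.
Proof.
rewrite -(@ler_pXn2r _ 2) ?nnegrE ?mulr_ge0 // exprMn -!inner_norm.
exact: (form_CauchySchwarz (@inner_linearl R H) (@innerC R H)
  (@inner_ge0 H) (@inner_eq0 H)).
Qed.

(** Vectors are separated by inner products; this is how identities between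
    adjoints are obtained below. *)
Lemma inner_inj H (x x' : H) : (forall y, inner x y = inner x' y) -> x = x'.
Proof.
move=> e; apply/eqP; rewrite -subr_eq0; apply/eqP/inner_eq0.
by rewrite innerBl e subrr.
Qed.

Lemma is_adjoint_sym H K (a : H -> K) b : is_adjoint a b -> is_adjoint b a.
Proof. by move=> ab x y; rewrite innerC -ab -innerC. Qed.

Lemma is_adjoint_uniq H K (a : H -> K) b b' : is_adjoint a b -> is_adjoint a b' -> b = b'.
Proof.
move=> ab ab'; apply/funext => y; apply: inner_inj => x.
by rewrite (is_adjoint_sym ab) (is_adjoint_sym ab').
Qed.

Lemma adjointE H (a b : H -> H) : is_adjoint a b -> adjoint a = b.
Proof.
move=> ab; apply: (is_adjoint_uniq _ ab).
by apply: (@xgetPex _ (fun=> 0) (is_adjoint a)); exists b.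
Qed.

Lemma is_adjoint_linear H K (a : H -> K) b : is_adjoint a b -> linear a.
Proof.
move=> ab c x y; apply: inner_inj => z.
by rewrite ab innerDl innerDl !innerZl !ab.
Qed.

Lemma is_adjointD H K (a a' : H -> K) b b' :
  is_adjoint a b -> is_adjoint a' b' -> is_adjoint (a + a') (b + b').
Proof. by move=> h h' x y; rewrite innerDl innerDr h h'. Qed.
Lemma is_adjointZ H K c (a : H -> K) b :
  is_adjoint a b -> is_adjoint (c *: a) (c^* *: b).
Proof. by move=> h x y; rewrite innerZl innerZr conjCK h. Qed.
Lemma is_adjoint0 H K : is_adjoint (0 : H -> K) 0.
Proof. by move=> x y; rewrite inner0l inner0r. Qed.
Lemma is_adjoint_comp H K L (a : K -> L) (a' : H -> K) b b' :
  is_adjoint a b -> is_adjoint a' b' -> is_adjoint (a \o a') (b' \o b).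
Proof. by move=> h h' x y; rewrite h h'. Qed.

End Inner.

(** * The *-ring of adjointable operators and its matrices *)

Section AdjointableOperators.
Context {R : realType} {H : hilbertType R}.
Implicit Types a b : H -> H.

(** Having an adjoint forces linearity, so this predicate alone cuts out a *-ring. *)
Definition adjointable : {pred (H -> H)} := fun a => `[< exists b, is_adjoint a b >].

Lemma adjointableP a : reflect (exists b, is_adjoint a b) (a \in adjointable).
Proof. exact: asboolP. Qed.

Lemma adjointable_submod : submod_closed adjointable.
Proof.
split; first by apply/adjointableP; exists 0; exact: is_adjoint0.
move=> c a a' /adjointableP[b ab] /adjointableP[b' ab'].
by apply/adjointableP; exists (c^* *: b + b'); apply: is_adjointD => //; exact: is_adjointZ.
Qed.

HB.instance Definition _ :=
  GRing.isSubmodClosed.Build R[i] (H -> H) adjointable adjointable_submod.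

Record adjop := AdjOp { opval :> H -> H ; opvalP : opval \in adjointable }.

HB.instance Definition _ := [isSub for opval].
HB.instance Definition _ := [Choice of adjop by <:].
HB.instance Definition _ := [SubChoice_isSubLmodule of adjop by <:].

End AdjointableOperators.
Arguments adjop {R} H.
Arguments adjointable {R} H.

Section AdjointableAlgebra.
Context {R : realType} {H : hilbertType R}.
Implicit Types a b c : adjop H.

Lemma opval_inj : injective (@opval R H).
Proof. exact: val_inj. Qed.
Lemma adjopE a b : (forall x, a x = b x) -> a = b.
Proof. by move=> e; apply: opval_inj; apply/funext. Qed.
Lemma opvalD a b : opval (a + b) = opval a + opval b. Proof. by []. Qed.
Lemma opvalZ (k : R[i]) a : opval (k *: a) = k *: opval a. Proof. by []. Qed.
Lemma opval0 : opval (0 : adjop H) = 0. Proof. by []. Qed.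
Lemma opval_sum I r (P : pred I) (F : I -> adjop H) :
  opval (\sum_(i <- r | P i) F i) = \sum_(i <- r | P i) opval (F i).
Proof. exact: (big_morph _ opvalD opval0). Qed.
Lemma opval_linear a : linear a.
Proof. by have /adjointableP[b /is_adjoint_linear] := opvalP a. Qed.

Lemma opmul_subproof a b : a \o b \in adjointable H.
Proof.
have /adjointableP[a' aa'] := opvalP a; have /adjointableP[b' bb'] := opvalP b.
by apply/adjointableP; exists (b' \o a'); exact: is_adjoint_comp.
Qed.
Lemma opone_subproof : (idfun : H -> H) \in adjointable H.
Proof. by apply/adjointableP; exists idfun. Qed.
Lemma opstar_subproof a : adjoint a \in adjointable H.
Proof.
have /adjointableP[b ab] := opvalP a.
by apply/adjointableP; exists a; rewrite (adjointE ab); exact: is_adjoint_sym.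
Qed.

Definition opmul a b := AdjOp (opmul_subproof a b).
Definition opone : adjop H := AdjOp opone_subproof.
Definition opstar a := AdjOp (opstar_subproof a).

Lemma opmulA : associative opmul. Proof. by move=> a b c; exact: adjopE. Qed.
Lemma opmul1l : left_id opone opmul. Proof. by move=> a; exact: adjopE. Qed.
Lemma opmul1r : right_id opone opmul. Proof. by move=> a; exact: adjopE. Qed.
Lemma opmulDl : left_distributive opmul +%R.
Proof. by move=> a b c; exact: adjopE. Qed.
Lemma opmulDr : right_distributive opmul +%R.
Proof.
move=> a b c; apply: adjopE => x /=.
by have := opval_linear a 1 (b x) (c x); rewrite !scale1r.
Qed.

HB.instance Definition _ := GRing.Zmodule_isPzRing.Build (adjop H)
  opmulA opmul1l opmul1r opmulDl opmulDr.

Lemma opvalM a b : opval (a * b) = a \o b. Proof. by []. Qed.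
Lemma opval1 : opval (1 : adjop H) = idfun. Proof. by []. Qed.

Lemma opstarP a : is_adjoint a (opstar a).
Proof. by have /adjointableP[b ab] := opvalP a; rewrite /= (adjointE ab). Qed.
Lemma opstarE a b : is_adjoint a b -> opstar a = b.
Proof. by move=> ab; apply: opval_inj; exact: adjointE. Qed.
Lemma opstarK : involutive opstar.
Proof. by move=> a; apply: opstarE; apply: is_adjoint_sym; exact: opstarP. Qed.
Lemma opstarD a b : opstar (a + b) = opstar a + opstar b.
Proof. by apply: opstarE; apply: is_adjointD; exact: opstarP. Qed.
Lemma opstarZ (k : R[i]) a : opstar (k *: a) = k^* *: opstar a.
Proof. by apply: opstarE; apply: is_adjointZ; exact: opstarP. Qed.
Lemma opstar0 : opstar 0 = 0.
Proof. by apply: opstarE; exact: is_adjoint0. Qed.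
Lemma opstar1 : opstar 1 = 1.
Proof. by apply: opstarE. Qed.
Lemma opstarM a b : opstar (a * b) = opstar b * opstar a.
Proof. by apply: opstarE; apply: is_adjoint_comp; exact: opstarP. Qed.
Lemma opstar_sum I r (P : pred I) (F : I -> adjop H) :
  opstar (\sum_(i <- r | P i) F i) = \sum_(i <- r | P i) opstar (F i).
Proof. exact: (big_morph _ opstarD opstar0). Qed.

Lemma opscaleAl (k : R[i]) a b : k *: (a * b) = (k *: a) * b.
Proof. exact: adjopE. Qed.
Lemma opscaleAr (k : R[i]) a b : k *: (a * b) = a * (k *: b).
Proof.
apply: adjopE => x /=; have := opval_linear a k (b x) 0.
have -> : a 0 = 0.
  apply: (addrI (a 0)); have := opval_linear a 1 0 0.
  by rewrite !scale1r !addr0 => <-.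
by rewrite !addr0 => e; exact: (esym e).
Qed.

End AdjointableAlgebra.

Section OperatorMatrices.
Context {R : realType} {H : hilbertType R}.
Local Notation A := (adjop H).

(** The matrix 1 (x) X of multiples of the identity. *)
Definition amp m n (X : 'M[R[i]]_(m, n)) : 'M[A]_(m, n) :=
  \matrix_(i, j) (X i j *: (1 : A)).
(** The entrywise adjoint, without transposition: the contragredient of a
    representation.  It does not reverse products, but commutes with
    multiplication by scalar matrices up to conjugating these. *)
Definition opconj m n (U : 'M[A]_(m, n)) : 'M[A]_(m, n) := map_mx opstar U.
Definition opadj m n (U : 'M[A]_(m, n)) : 'M[A]_(n, m) := (opconj U)^T.

Lemma ampM m n p (X : 'M[R[i]]_(m, n)) (Y : 'M[R[i]]_(n, p)) : amp (X *m Y) = amp X *m amp Y.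
Proof.
apply/matrixP => i j; rewrite !mxE scaler_suml; apply: eq_bigr => k _.
by rewrite !mxE -opscaleAl mul1r scalerA.
Qed.
Lemma amp1 n : amp (1%:M : 'M[R[i]]_n) = 1%:M.
Proof. by apply/matrixP => i j; rewrite !mxE; case: eqP; rewrite ?scale1r ?scale0r. Qed.
Lemma amp0 m n : amp (0 : 'M[R[i]]_(m, n)) = 0.
Proof. by apply/matrixP => i j; rewrite !mxE scale0r. Qed.
Lemma ampB m n (X Y : 'M[R[i]]_(m, n)) : amp (X - Y) = amp X - amp Y.
Proof. by apply/matrixP => i j; rewrite !mxE scalerBl. Qed.
Lemma opconjK m n : involutive (@opconj m n).
Proof. by move=> U; apply/matrixP => i j; rewrite !mxE opstarK. Qed.
Lemma opadjK m n (U : 'M[A]_(m, n)) : opadj (opadj U) = U.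
Proof. by apply/matrixP => i j; rewrite !mxE opstarK. Qed.
Lemma opadjM m n p (U : 'M[A]_(m, n)) (V : 'M[A]_(n, p)) : opadj (U *m V) = opadj V *m opadj U.
Proof.
apply/matrixP => i j; rewrite !mxE opstar_sum; apply: eq_bigr => k _.
by rewrite !mxE opstarM.
Qed.
Lemma opadj_amp m n (X : 'M[R[i]]_(m, n)) : opadj (amp X) = amp (X ^t*).
Proof. by apply/matrixP => i j; rewrite !mxE opstarZ opstar1. Qed.
Lemma amp_mulmxE m n p (X : 'M[R[i]]_(m, n)) (U : 'M[A]_(n, p)) i j :
  (amp X *m U) i j = \sum_k X i k *: U k j.
Proof. by rewrite mxE; apply: eq_bigr => k _; rewrite !mxE -opscaleAl mul1r. Qed.
Lemma mulmx_ampE m n p (U : 'M[A]_(m, n)) (X : 'M[R[i]]_(n, p)) i j :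
  (U *m amp X) i j = \sum_k X k j *: U i k.
Proof. by rewrite mxE; apply: eq_bigr => k _; rewrite !mxE -opscaleAr mulr1. Qed.
Lemma opconj_ampl m n p (X : 'M[R[i]]_(m, n)) (U : 'M[A]_(n, p)) :
  opconj (amp X *m U) = amp (map_mx Num.conj X) *m opconj U.
Proof.
apply/matrixP => i j; rewrite amp_mulmxE mxE amp_mulmxE opstar_sum.
by apply: eq_bigr => k _; rewrite opstarZ !mxE.
Qed.
Lemma opconj_ampr m n p (U : 'M[A]_(m, n)) (X : 'M[R[i]]_(n, p)) :
  opconj (U *m amp X) = opconj U *m amp (map_mx Num.conj X).
Proof.
apply/matrixP => i j; rewrite mulmx_ampE mxE mulmx_ampE opstar_sum.
by apply: eq_bigr => k _; rewrite opstarZ !mxE.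
Qed.
Lemma tr_ampl m n p (X : 'M[R[i]]_(m, n)) (U : 'M[A]_(n, p)) :
  (amp X *m U)^T = U^T *m amp X^T.
Proof.
by apply/matrixP => i j; rewrite mxE amp_mulmxE mulmx_ampE; apply: eq_bigr => k _; rewrite !mxE.
Qed.
Definition opmx m n (U : 'M[A]_(m, n)) : 'M[H -> H]_(m, n) := map_mx (@opval R H) U.

Lemma opmx_inj m n : injective (@opmx m n).
Proof.
move=> U V e; apply/matrixP => i j; apply: opval_inj.
by move/matrixP: e => /(_ i j); rewrite !mxE.
Qed.
Lemma opmxM n (U V : 'M[A]_n) : opmx (U *m V) = opmx_mul (opmx U) (opmx V).
Proof.
apply/matrixP => i j; rewrite !mxE opval_sum; apply: eq_bigr => k _.
by rewrite !mxE.
Qed.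
Lemma opmx_opadj n (U : 'M[A]_n) : opmx (opadj U) = opmx_star (opmx U).
Proof. by apply/matrixP => i j; rewrite !mxE. Qed.
Lemma opmx_conj n (U : 'M[A]_n) : opmx (opconj U) = map_mx (@adjoint R H) (opmx U).
Proof. by apply/matrixP => i j; rewrite !mxE. Qed.
Lemma opmx_ampE n (X : 'M[R[i]]_n) : opmx (amp X) = opmx_amp H X.
Proof. by apply/matrixP => i j; rewrite !mxE. Qed.

Lemma opmx_lift m n (u : 'M[H -> H]_(m, n)) :
  (forall i j, u i j \in adjointable H) -> exists U, opmx U = u.
Proof.
move=> ua; exists (\matrix_(i, j) AdjOp (ua i j)).
by apply/matrixP => i j; rewrite !mxE.
Qed.

End OperatorMatrices.

(** * Extension of densely defined bounded operators *)

Section BoundedMaps.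
Context {R : realType}.
Implicit Types H K L : hilbertType R.
Local Notation C := R[i].

Lemma bounded_opP H K (a : H -> K) : bounded_op a ->
  exists2 M : C, 0 <= M & forall x, `|a x| <= M * `|x|.
Proof.
move=> [la ca].
pose f : {linear H -> K} := HB.pack a (GRing.isLinear.Build _ _ _ _ a la).
have /linear_boundedP : bounded_near f (nbhs 0) by exact/linear_bounded_continuous.
move=> [M [Mreal hM]]; exists (`|M| + 1); first by rewrite addr_ge0.
move=> x; apply: (hM (`|M| + 1)).
by rewrite ltr_pwDr // real_ler_norm.
Qed.

Lemma lipschitz_bounded_op H K (a : H -> K) (M : C) : linear a -> 0 <= M ->
  (forall x, `|a x| <= M * `|x|) -> bounded_op a.
Proof.
move=> la M0 hM; split=> // x.
pose f : {linear H -> K} := HB.pack a (GRing.isLinear.Build _ _ _ _ a la).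
have faE : forall z w, a z - a w = a (z - w) by move=> z w; exact: esym (linearB f z w).
apply/cvgrPdist_lt => e e0.
have M1 : 0 < M + 1 by rewrite ltr_pwDr.
near=> z.
rewrite faE; apply: (le_lt_trans (hM _)).
apply: (@le_lt_trans _ _ ((M + 1) * `|x - z|)).
  by rewrite ler_wpM2r // lerDl.
rewrite mulrC -ltr_pdivlMr //.
near: z; apply/nbhs_ballP; exists (e / (M + 1)); first by rewrite /= divr_gt0.
by move=> z; rewrite -ball_normE.
Unshelve. all: by end_near. Qed.

Lemma dense_approx H (D : set H) : dense D ->
  forall z (e : C), 0 < e -> exists2 z', D z' & `|z - z'| < e.
Proof.
move=> dD z e e0.
have [||z' [/interior_subset]] := dD (ball z e)°.
- exists z; exact: nbhsx_ballx.
- exact: open_interior.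
by rewrite -ball_normE => zz' Dz'; exists z'.
Qed.

(** The partial operator is given by its graph D, which need not be presented as
    a function: a vector may be written as a sum of simple tensors in many ways,
    and single-valuedness is a consequence of the bound. *)
Section Extension.
Context {L K : hilbertType R} (D : L -> K -> Prop) (M : C).
Hypothesis D_linear : forall c z w z' w',
  D z w -> D z' w' -> D (c *: z + z') (c *: w + w').
Hypothesis M_ge0 : 0 <= M.
Hypothesis D_bounded : forall z w, D z w -> `|w| <= M * `|z|.
Hypothesis D_dense : dense [set z | exists w, D z w].

(* G is the closure of the graph D. *)
Let G z w := forall e : C, 0 < e ->
  exists z' w', [/\ D z' w', `|z - z'| < e & `|w - w'| < e].

Let G_bounded z w : G z w -> `|w| <= M * `|z|.
Proof.
move=> Gzw; apply/ler_addgt0Pr => e e0.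
have M1 : 0 < M + 1 by rewrite ltr_pwDr.
have [|z' [w' [Dz' zz' ww']]] := Gzw (e / (M + 1)); first by rewrite divr_gt0.
have hw : `|w| <= `|w'| + e / (M + 1).
  by rewrite -[X in `|X|](subrK w') addrC (le_trans (ler_normD _ _)) // lerD2l ltW.
have hz : `|z'| <= `|z| + e / (M + 1).
  by rewrite -[X in `|X|](subrK z) addrC (le_trans (ler_normD _ _)) // lerD2l distrC ltW.
apply: (le_trans hw); rewrite -lerBrDr.
apply: (le_trans (D_bounded Dz')).
apply: (le_trans (ler_wpM2l M_ge0 hz)).
rewrite mulrDr lerBrDr -addrA lerD2l -[X in _ + X]mul1r -mulrDl mulrC divfK //.
by rewrite gt_eqF.
Qed.

Let G_linear c z w z' w' : G z w -> G z' w' -> G (c *: z + z') (c *: w + w').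
Proof.
move=> h h' e e0.
have c1 : 0 < `|c| + 1 by rewrite ltr_pwDr.
pose d := e / (`|c| + 1); have d0 : 0 < d by rewrite divr_gt0.
have [z1 [w1 [D1 hz1 hw1]]] := h d d0.
have [z2 [w2 [D2 hz2 hw2]]] := h' d d0.
have key (W : hilbertType R) (x x' y y' : W) : `|x - y| < d -> `|x' - y'| < d ->
    `|c *: x + x' - (c *: y + y')| < e.
  move=> hx hx'; rewrite opprD addrACA -scalerBr.
  apply: (le_lt_trans (ler_normD _ _)); rewrite normrZ.
  have -> : e = `|c| * d + d.
    by rewrite -[X in _ + X]mul1r -mulrDl mulrC divfK // gt_eqF.
  by rewrite ler_ltD // ler_wpM2l // ltW.
exists (c *: z1 + z2), (c *: w1 + w2); split; [exact: D_linear|exact: key|exact: key].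
Qed.

Let G_sub z w : D z w -> G z w.
Proof. by move=> Dzw e e0; exists z, w; rewrite !subrr !normr0. Qed.

Let G_total z : exists w, G z w.
Proof.
(* The images of the approximants of z form a Cauchy filter, whose limit is w. *)
pose B (e : C) := [set w | exists2 z', D z' w & `|z - z'| < e].
pose F := filter_from [set e : C | 0 < e] B.
have M1 : 0 < M + 1 by rewrite ltr_pwDr.
have FF : Filter F.
  apply: filter_from_filter; first by exists 1; rewrite /= ltr01.
  move=> e e' e0 e'0.
  have [le|le] := real_leP (gtr0_real e0) (gtr0_real e'0).
    exists e => // w [z' Dz' hz']; split; exists z' => //.
    exact: lt_le_trans le.
  exists e' => // w [z' Dz' hz']; split; exists z' => //.
  exact: lt_trans le.
have PF : ProperFilter F.
  apply: filter_from_proper => e e0.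
  by have [z' [w Dw] hz'] := dense_approx D_dense z e0; exists w, z'.
have : cauchy F.
  apply: cauchy_exP => e e0.
  pose d := e / (M + 1) / 2; have d0 : 0 < d by rewrite !divr_gt0.
  have [z' [w Dw] hz'] := dense_approx D_dense z d0.
  exists w; exists d => // w2 [z2 D2 hz2].
  rewrite -ball_normE /=.
  have D3 : D (z' - z2) (w - w2).
    by rewrite -(scaleN1r z2) -(scaleN1r w2) addrC [w + _]addrC; exact: D_linear.
  apply: (le_lt_trans (D_bounded D3)).
  have hd : `|z' - z2| < e / (M + 1).
    rewrite [ltRHS]splitr; apply: le_lt_trans (ler_distD z _ _) _.
    by rewrite ltrD // distrC.
  apply: (@le_lt_trans _ _ ((M + 1) * `|z' - z2|)).
    by rewrite ler_wpM2r // lerDl.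
  by rewrite mulrC -ltr_pdivlMr.
move=> /cauchy_cvg/cvg_ex[w Fw]; exists w => e e0.
have : F (ball w e `&` B e).
  apply: filterI; last by exists e.
  by apply: Fw; exact: nbhsx_ballx.
by move=> /filter_ex[w' [+ [z' Dz' hz']]]; rewrite -ball_normE; exists z', w'.
Qed.

Lemma bounded_extension : exists2 f : L -> K, bounded_op f &
  forall z w, D z w -> f z = w.
Proof.
have [f fG] := choice G_total.
have fun_ z w w' : G z w -> G z w' -> w = w'.
  move=> h h'; apply/eqP; rewrite -subr_eq0 -normr_le0.
  have := G_linear (-1) h' h; rewrite !scaleN1r [- z + _]addrC subrr.
  by move=> /G_bounded; rewrite normr0 mulr0 addrC.
exists f; last by move=> z w /G_sub; exact: fun_.
apply: (lipschitz_bounded_op _ M_ge0) => [c z z'|z]; last exact: G_bounded.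
by apply: (fun_ (c *: z + z')) => //; exact: G_linear.
Qed.

End Extension.

End BoundedMaps.

(** * Tensor products of bounded operators *)

Section Tensor.
Context {R : realType}.
Implicit Types H K L : hilbertType R.
Local Notation C := R[i].

Definition inner_bilinear H K L (t : H -> K -> L) : Prop :=
  [/\ forall y, linear (t^~ y), forall x, linear (t x) &
     forall x x' y y', inner (t x y) (t x' y') = inner x x' * inner y y'].

Lemma inner_bilinear_swap H K L (t : H -> K -> L) :
  inner_bilinear t -> inner_bilinear (fun y x => t x y).
Proof. by case=> tl tr ti; split=> // *; rewrite ti mulrC. Qed.

Section Elementary.
Context {H K L : hilbertType R} (t : H -> K -> L).
Hypothesis tP : inner_bilinear t.
Let tl := let: And3 h _ _ := tP in h.
Let tr := let: And3 _ h _ := tP in h.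
Let ti := let: And3 _ _ h := tP in h.

Lemma tensDl x x' y : t (x + x') y = t x y + t x' y.
Proof. by have := tl y 1 x x'; rewrite !scale1r. Qed.
Lemma tensDr x y y' : t x (y + y') = t x y + t x y'.
Proof. by have := tr x 1 y y'; rewrite !scale1r. Qed.
Lemma tens0l y : t 0 y = 0.
Proof. by apply: (addrI (t 0 y)); rewrite -tensDl !addr0. Qed.
Lemma tens0r x : t x 0 = 0.
Proof. by apply: (addrI (t x 0)); rewrite -tensDr !addr0. Qed.
Lemma tensZl c x y : t (c *: x) y = c *: t x y.
Proof. by have := tl y c x 0; rewrite tens0l !addr0. Qed.
Lemma tensZr c x y : t x (c *: y) = c *: t x y.
Proof. by have := tr x c y 0; rewrite tens0r !addr0. Qed.
Lemma tens_sumr I r (P : pred I) x (F : I -> K) :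
  t x (\sum_(i <- r | P i) F i) = \sum_(i <- r | P i) t x (F i).
Proof. exact: (big_morph (t x) (tensDr x) (tens0r x)). Qed.

(** Gram-Schmidt in the second leg.  The same coefficients serve for every linear
    operator applied to the first leg, in particular for the identity; a zero
    vector e k is harmless since inverses of 0 are 0. *)
Lemma tens_orthogonalize n (x : 'I_n -> H) (y : 'I_n -> K) :
  exists m (x' : 'I_m -> H) (e : 'I_m -> K),
    (forall k l, k != l -> inner (e k) (e l) = 0) /\
    forall a : H -> H, linear a ->
      \sum_i t (a (x i)) (y i) = \sum_k t (a (x' k)) (e k).
Proof.
elim: n x y => [|n IHn] x y.
  exists 0, (fun=> 0), (fun=> 0); split => [[]//|a la].
  by rewrite !big_ord0.
have [m [x' [e [eo eE]]]] := IHn (x \o lift ord0) (y \o lift ord0).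
pose c k := inner (y ord0) (e k) / inner (e k) (e k).
pose e0 := y ord0 - \sum_k c k *: e k.
have e0o k : inner e0 (e k) = 0.
  rewrite innerBl inner_suml (bigD1 k) //= big1 ?addr0 => [|l lk].
    rewrite innerZl /c; have [ek0|ekN0] := eqVneq (inner (e k) (e k)) 0.
      by rewrite (inner_eq0 ek0) !inner0r mulr0 subrr.
    by rewrite divfK // subrr.
  by rewrite innerZl eo // mulr0.
pose x0 := x ord0.
exists m.+1, (fun i => oapp (fun k => x' k + c k *: x0) x0 (unlift ord0 i)).
exists (fun i => oapp e e0 (unlift ord0 i)); split => [k l|a la].
  case: (unliftP ord0 k) => [k'|] ->; case: (unliftP ord0 l) => [l'|] -> //=;
    rewrite ?liftK ?unlift_none ?eqxx //=.
  - by rewrite (inj_eq lift_inj); exact: eo.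
  - by rewrite innerC e0o conjC0.
rewrite !big_ord_recl unlift_none /= eE //.
under [in RHS]eq_bigr => k _ do rewrite liftK /=.
have aD u v k : a (u + k *: v) = a u + k *: a v by rewrite addrC la addrC.
under [in RHS]eq_bigr => k _ do rewrite aD tensDl tensZl -tensZr.
rewrite big_split /= -tens_sumr [RHS]addrCA [LHS]addrC; congr (_ + _).
by rewrite -tensDr subrK.
Qed.

(** With the second leg orthogonal both sides are computed by Pythagoras and
    compared term by term. *)
Lemma tens_bound (a : H -> H) (M : C) : linear a -> 0 <= M ->
    (forall x, `|a x| <= M * `|x|) ->
  forall n (x : 'I_n -> H) (y : 'I_n -> K),
    `|\sum_i t (a (x i)) (y i)| <= M * `|\sum_i t (x i) (y i)|.
Proof.
move=> la M0 hM n x y.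
have [m [x' [e [eo eE]]]] := tens_orthogonalize x y.
have id_lin : linear (@idfun H) by [].
rewrite eE // (eE idfun id_lin) /=.
have sq (b : H -> H) : `|\sum_k t (b (x' k)) (e k)| ^+ 2 =
    \sum_k `|b (x' k)| ^+ 2 * `|e k| ^+ 2.
  rewrite -inner_norm inner_suml; apply: eq_bigr => k _.
  rewrite inner_sumr (bigD1 k) //= big1 ?addr0 ?ti ?inner_norm // => l lk.
  by rewrite ti eo ?mulr0 // eq_sym.
rewrite -(@ler_pXn2r _ 2) ?nnegrE ?mulr_ge0 // exprMn sq (sq idfun) mulr_sumr.
apply: ler_sum => k _; rewrite [leRHS]mulrA; apply: ler_wpM2r; rewrite ?exprn_ge0 // -exprMn.
by rewrite ler_pXn2r ?nnegrE ?mulr_ge0.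
Qed.

End Elementary.

Section HilbertTensor.
Context {H K L : hilbertType R} (t : H -> K -> L).
Hypothesis tP : hilbert_tensor t.
Let tP' : inner_bilinear t. Proof. by case: tP. Qed.
Let tdense : dense [set z | exists n (x : 'I_n -> H) (y : 'I_n -> K),
                       z = \sum_(i < n) t (x i) (y i)].
Proof. by case: tP. Qed.

(** Bounding first a (x) 1 and then, after swapping the legs, 1 (x) b gives the
    bound Ma Mb on elementary sums. *)
Lemma tensor_op_exists (a : H -> H) (b : K -> K) : bounded_op a -> bounded_op b ->
  exists c, bounded_op c /\ forall x y, c (t x y) = t (a x) (b y).
Proof.
move=> ab bb; have [Ma Ma0 hMa] := bounded_opP ab; have [Mb Mb0 hMb] := bounded_opP bb.
have [[la _] [lb _]] := (ab, bb).
pose D z w := exists n (x : 'I_n -> H) (y : 'I_n -> K),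
  z = \sum_i t (x i) (y i) /\ w = \sum_i t (a (x i)) (b (y i)).
have D1 x y : D (t x y) (t (a x) (b y)).
  by exists 1%N, (fun=> x), (fun=> y); rewrite !big_ord1.
have DD z w z' w' : D z w -> D z' w' -> D (z + z') (w + w').
  move=> [n [x [y [-> ->]]]] [n' [x' [y' [-> ->]]]].
  exists (n + n')%N.
  exists (fun i : 'I_(n + n') => match fintype.split i with inl j => x j | inr j => x' j end).
  exists (fun i : 'I_(n + n') => match fintype.split i with inl j => y j | inr j => y' j end).
  rewrite !big_split_ord /=.
  have sl (j : 'I_n) : fintype.split (lshift n' j) = inl j := unsplitK (inl j).
  have sr (j : 'I_n') : fintype.split (rshift n j) = inr j := unsplitK (inr j).
  by split; congr (_ + _); apply: eq_bigr => j _; rewrite ?sl ?sr.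
have az k u : a (k *: u) = k *: a u.
  have a0 : a 0 = 0 by apply: (addrI (a 0)); have := la 1 0 0; rewrite !scale1r !addr0 => <-.
  by have := la k u 0; rewrite a0 !addr0.
have DZ c z w : D z w -> D (c *: z) (c *: w).
  move=> [n [x [y [-> ->]]]]; exists n, (fun i => c *: x i), y.
  by split; rewrite scaler_sumr; apply: eq_bigr => j _; rewrite ?az (tensZl tP').
have [||||f fb fE] := @bounded_extension R L L D (Ma * Mb).
- by move=> c z w z' w' h h'; apply: DD => //; exact: DZ.
- by rewrite mulr_ge0.
- move=> z w [n [x [y [-> ->]]]]; rewrite -mulrA.
  apply: (le_trans (tens_bound tP' la Ma0 hMa x (b \o y))).
  by rewrite ler_wpM2l //; exact: (tens_bound (inner_bilinear_swap tP') lb Mb0 hMb y x).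
- move=> O O0 Oo; have [z [Oz [n [x [y zE]]]]] := tdense O0 Oo.
  by exists z; split => //; exists (\sum_i t (a (x i)) (b (y i))), n, x, y.
by exists f; split => // x y; apply: fE.
Qed.

Lemma bounded_op_eq_tens K' (c d : L -> K') : bounded_op c -> bounded_op d ->
  (forall x y, c (t x y) = d (t x y)) -> c = d.
Proof.
move=> cb db cd.
have [[lc _] [ld _]] := (cb, db).
have [M M0 hM] := bounded_opP cb; have [N N0 hN] := bounded_opP db.
pose f : {linear L -> K'} := HB.pack c (GRing.isLinear.Build _ _ _ _ c lc).
pose g : {linear L -> K'} := HB.pack d (GRing.isLinear.Build _ _ _ _ d ld).
apply/funext => z; apply/eqP; rewrite -subr_eq0 -normr_le0; apply/ler_addgt0Pr => e e0.
have MN : 0 < M + N + 1 by rewrite ltr_pwDr // addr_ge0.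
have [|z' [n [x [y z'E]]] hz'] := dense_approx tdense z (e := e / (M + N + 1)).
  by rewrite divr_gt0.
have fg : f z' = g z'.
  by rewrite z'E !linear_sum; apply: eq_bigr => i _; exact: cd.
have -> : c z - d z = f (z - z') - g (z - z').
  by rewrite (linearB f) (linearB g) opprB addrA fg subrK.
rewrite add0r; apply: (le_trans (ler_normB _ _)).
apply: (le_trans (lerD (hM _) (hN _))); rewrite -mulrDl.
apply: (@le_trans _ _ ((M + N + 1) * `|z - z'|)).
  by rewrite ler_wpM2r // lerDl.
by rewrite mulrC -ler_pdivlMr // ltW.
Qed.

Lemma tensor_opP a b : bounded_op a -> bounded_op b ->
  bounded_op (tensor_op t a b) /\
  forall x y, tensor_op t a b (t x y) = t (a x) (b y).
Proof.
move=> ab bb.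
exact: (@xgetPex _ (fun=> 0)
  [set c | bounded_op c /\ forall x y, c (t x y) = t (a x) (b y)]
  (tensor_op_exists ab bb)).
Qed.

Lemma tensor_op_uniq a b c : bounded_op a -> bounded_op b -> bounded_op c ->
  (forall x y, c (t x y) = t (a x) (b y)) -> c = tensor_op t a b.
Proof.
move=> ab bb cb cE; have [tb tE] := tensor_opP ab bb.
by apply: bounded_op_eq_tens => // x y; rewrite cE tE.
Qed.

End HilbertTensor.
End Tensor.

(** * Linear closure properties of bounded operators and bicommutants *)

Section BoundedAlgebra.
Context {R : realType}.
Implicit Types H K L : hilbertType R.

Lemma bounded_op_lin H K (a b : H -> K) (c : R[i]) :
  bounded_op a -> bounded_op b -> bounded_op (c *: a + b).
Proof.
move=> ab bb; have [[la _] [lb _]] := (ab, bb).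
have [M M0 hM] := bounded_opP ab; have [N N0 hN] := bounded_opP bb.
apply: (@lipschitz_bounded_op _ _ _ _ (`|c| * M + N)).
- move=> k x y; rewrite -[RHS]/(k *: (c *: a x + b x) + (c *: a y + b y)).
  rewrite -[LHS]/(c *: a (k *: x + y) + b (k *: x + y)) la lb.
  by rewrite !scalerDr !scalerA addrACA [c * k]mulrC.
- by rewrite addr_ge0 // mulr_ge0.
- move=> x; rewrite (le_trans (ler_normD _ _)) // mulrDl lerD //.
  by rewrite normrZ -mulrA ler_wpM2l.
Qed.

Lemma bounded_op0 H K : bounded_op (0 : H -> K).
Proof.
apply: (@lipschitz_bounded_op _ _ _ _ 0) => // [k x y|x].
  by rewrite scaler0 addr0.
by rewrite normr0 mul0r.
Qed.

Lemma bounded_op_comp H K L (a : K -> L) (b : H -> K) :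
  bounded_op a -> bounded_op b -> bounded_op (a \o b).
Proof.
move=> ab bb; have [[la _] [lb _]] := (ab, bb).
have [M M0 hM] := bounded_opP ab; have [N N0 hN] := bounded_opP bb.
apply: (@lipschitz_bounded_op _ _ _ _ (M * N)).
- by move=> k x y; rewrite /= lb la.
- by rewrite mulr_ge0.
- by move=> x; rewrite (le_trans (hM _)) // -mulrA ler_wpM2l.
Qed.

Lemma bounded_op_sum H K I (r : seq I) (c : I -> R[i]) (a : I -> H -> K) :
  (forall i, bounded_op (a i)) -> bounded_op (\sum_(i <- r) c i *: a i).
Proof.
move=> ab; elim: r => [|i r IH]; first by rewrite big_nil; exact: bounded_op0.
by rewrite big_cons; exact: bounded_op_lin.
Qed.

Lemma bounded_op_id H : bounded_op (@idfun H).
Proof. by split=> // x; exact: cvg_id. Qed.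

Lemma sub_bicommutant H (X : set (H -> H)) a :
  bounded_op a -> X a -> commutant (commutant X) a.
Proof. by move=> ab Xa; split => // b [bb /(_ _ Xa)->]. Qed.

Lemma bicommutant_lin H (X : set (H -> H)) (c : R[i]) a b :
  commutant (commutant X) a -> commutant (commutant X) b ->
  commutant (commutant X) (c *: a + b).
Proof.
move=> [ab aX] [bb bX]; split; first exact: bounded_op_lin.
move=> d Xd; have [[ld _] _] := Xd; apply/funext => x.
rewrite -[RHS]/(d (c *: a x + b x)) ld.
by rewrite -[d (a x)]/((d \o a) x) -[d (b x)]/((d \o b) x) -aX // -bX.
Qed.

Lemma bicommutant0 H (X : set (H -> H)) : commutant (commutant X) 0.
Proof.
split; first exact: bounded_op0.
move=> d [[ld _] _]; apply/funext => x /=.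
rewrite -[LHS]/(0 : H); apply: (addrI (d 0)); have := ld 1 0 0.
by rewrite !scale1r !addr0.
Qed.

Lemma bicommutant_comp H (X : set (H -> H)) a b :
  commutant (commutant X) a -> commutant (commutant X) b ->
  commutant (commutant X) (a \o b).
Proof.
move=> [ab aX] [bb bX]; split; first exact: bounded_op_comp.
by move=> d Xd; rewrite -compA bX // compA aX.
Qed.

Definition lin_closed H (M : set (H -> H)) :=
  M 0 /\ forall (c : R[i]) a b, M a -> M b -> M (c *: a + b).

Lemma bicommutant_lin_closed H (X : set (H -> H)) : lin_closed (commutant (commutant X)).
Proof. by split=> [|c a b]; [exact: bicommutant0|exact: bicommutant_lin]. Qed.

Lemma lin_closed_sum H (M : set (H -> H)) I (r : seq I) (c : I -> R[i]) (a : I -> H -> H) :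
  lin_closed M -> (forall i, M (a i)) -> M (\sum_(i <- r) c i *: a i).
Proof.
by move=> [M0 MD] Ma; elim: r => [|i r IH]; rewrite ?big_nil ?big_cons //; exact: MD.
Qed.

Lemma linear_on_sum H (V : lmodType R[i]) (M : set (H -> H)) (Phi : (H -> H) -> V)
    I (r : seq I) (c : I -> R[i]) (a : I -> H -> H) :
  lin_closed M -> linear_on M Phi -> (forall i, M (a i)) ->
  Phi (\sum_(i <- r) c i *: a i) = \sum_(i <- r) c i *: Phi (a i).
Proof.
move=> lM lP Ma; have [M0 MD] := lM; elim: r => [|i r IH].
  rewrite !big_nil; apply: (addrI (Phi 0)).
  by have := lP 1 0 0 M0 M0; rewrite !scale1r !addr0.
by rewrite !big_cons lP ?IH //; exact: lin_closed_sum.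
Qed.

(** Simple tensors are total, so inner products with them determine a vector. *)
Lemma ortho_tens0 H K L (t : H -> K -> L) (z : L) : hilbert_tensor t ->
  (forall x y, inner z (t x y) = 0) -> z = 0.
Proof.
move=> [_ _ _ tdense] zt; apply/eqP; rewrite -normr_le0; apply/ler_addgt0Pr => e e0.
have [w [n [x [y ->]]] hw] := dense_approx tdense z e0.
rewrite add0r; have [->|z0] := eqVneq z 0; first by rewrite normr0 ltW.
rewrite -(@ler_pM2l _ `|z|) ?normr_gt0 // -expr2 -inner_norm.
have -> : inner z z = inner z (z - \sum_i t (x i) (y i)).
  rewrite innerDr -scaleN1r innerZr inner_sumr big1 ?mulr0 ?addr0 //.
rewrite -[leLHS]ger0_norm; last first.
  rewrite innerDr -scaleN1r innerZr inner_sumr big1 ?mulr0 ?addr0 //.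
  exact: inner_ge0.
apply: (le_trans (inner_CauchySchwarz _ _)).
by rewrite ler_wpM2l // ltW.
Qed.

End BoundedAlgebra.

(** * Representations and their contragredients *)

Section QuantumGroup.
Context {R : realType} (G : compactQuantumGroup R).
Local Notation H := (qgH G).
Local Notation HH := (qgHH G).
Local Notation A := (adjop H).
Local Notation M := (@Linf R G).
Local Notation MM := (vn_tensor (@tens R G) M M).
Implicit Types (a b : A) (n : nat).

Lemma LinfE : commutant (commutant M) = M.
Proof. by have [] := LinfP G. Qed.

Lemma Linf_bounded (a : H -> H) : M a -> bounded_op a.
Proof. by rewrite -LinfE => -[]. Qed.
Lemma Linf_adjointable (a : H -> H) : M a -> a \in adjointable H.
Proof. by have [h _] := LinfP G; move=> /h[b _ ab]; apply/adjointableP; exists b. Qed.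
Lemma Linf_star a : M a -> M (opstar a).
Proof. by have [h _] := LinfP G; move=> /h[b Mb ab]; rewrite /= (adjointE ab). Qed.
Lemma Linf_lin_closed : lin_closed M.
Proof. by rewrite -LinfE; exact: bicommutant_lin_closed. Qed.
Lemma Linf_sum I (r : seq I) (c : I -> R[i]) (a : I -> A) :
  (forall i, M (a i)) -> M (\sum_(i <- r) c i *: a i).
Proof.
move=> Ma; rewrite opval_sum.
exact: (@lin_closed_sum _ _ _ _ r c (fun i => opval (a i)) Linf_lin_closed).
Qed.
Lemma LinfM a b : M a -> M b -> M (a * b).
Proof. by rewrite opvalM -LinfE => Ma Mb; exact: bicommutant_comp. Qed.
Lemma Linf_sum1 I (r : seq I) (a : I -> A) : (forall i, M (a i)) -> M (\sum_(i <- r) a i).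
Proof.
by move=> Ma; have := Linf_sum r (fun=> 1) Ma; under eq_bigr do rewrite scale1r.
Qed.

Definition tens2 a b : HH -> HH := tensor_op (@tens R G) a b.

Lemma tens2P a b : M a -> M b ->
  bounded_op (tens2 a b) /\ forall x y, tens2 a b (tens x y) = tens (a x) (b y).
Proof. by move=> /Linf_bounded ab /Linf_bounded bb; exact: (tensor_opP (tensP G)). Qed.

Lemma tens2_uniq a b c : M a -> M b -> bounded_op c ->
  (forall x y, c (tens x y) = tens (a x) (b y)) -> c = tens2 a b.
Proof. by move=> /Linf_bounded ab /Linf_bounded bb; exact: (tensor_op_uniq (tensP G)). Qed.

Lemma tens2_in a b : M a -> M b -> MM (tens2 a b).
Proof.
move=> Ma Mb; apply: sub_bicommutant; first by have [] := tens2P Ma Mb.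
by exists (a : H -> H) => //; exists (b : H -> H).
Qed.

Let tb : inner_bilinear (@tens R G). Proof. by case: (tensP G). Qed.

Lemma tens2_suml I (r : seq I) (c : I -> R[i]) (a : I -> A) b :
  (forall i, M (a i)) -> M b ->
  tens2 (\sum_(i <- r) c i *: a i) b = \sum_(i <- r) c i *: tens2 (a i) b.
Proof.
move=> Ma Mb; apply/esym/tens2_uniq => //; first exact: Linf_sum.
  by apply: bounded_op_sum => i; have [] := tens2P (Ma i) Mb.
move=> x y; rewrite opval_sum !fct_sumE.
rewrite (big_morph (fun z => tens z (b y)) (fun u v => tensDl tb u v _) (tens0l tb _)).
apply: eq_bigr => i _; have [_ tE] := tens2P (Ma i) Mb.
by rewrite -[LHS]/(c i *: tens2 (a i) b (tens x y)) tE -(tensZl tb).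
Qed.

Lemma tens2_sumr I (r : seq I) (c : I -> R[i]) a (b : I -> A) :
  M a -> (forall i, M (b i)) ->
  tens2 a (\sum_(i <- r) c i *: b i) = \sum_(i <- r) c i *: tens2 a (b i).
Proof.
move=> Ma Mb; apply/esym/tens2_uniq => //; first exact: Linf_sum.
  by apply: bounded_op_sum => i; have [] := tens2P Ma (Mb i).
move=> x y; rewrite opval_sum !fct_sumE (tens_sumr tb).
apply: eq_bigr => i _; have [_ tE] := tens2P Ma (Mb i).
by rewrite -[LHS]/(c i *: tens2 a (b i) (tens x y)) tE -(tensZr tb).
Qed.

Lemma tens2_comp a b a' b' : M a -> M b -> M a' -> M b' ->
  tens2 a b \o tens2 a' b' = tens2 (a * a') (b * b').
Proof.
move=> Ma Mb Ma' Mb'; have [bt tE] := tens2P Ma Mb; have [bt' tE'] := tens2P Ma' Mb'.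
apply: tens2_uniq; [exact: LinfM|exact: LinfM|exact: bounded_op_comp|].
by move=> x y /=; rewrite tE' tE.
Qed.

(** The entries of A_13 B_23. *)
Definition tensmx n (U V : 'M[A]_n) i j : HH -> HH := \sum_k tens2 (U i k) (V k j).

Definition Linfmx n (U : 'M[A]_n) := forall i j, M (U i j).
Definition repmx n (U : 'M[A]_n) :=
  Linfmx U /\ forall i j, comul (U i j) = tensmx U U i j.

Lemma repmxP n (U : 'M[A]_n) : repmx U <-> representation (opmx U).
Proof.
split=> -[h h']; split=> i j.
- by rewrite mxE.
- by rewrite mxE h'; apply: eq_bigr => k _; rewrite !mxE.
- by have := h i j; rewrite mxE.
- by have := h' i j; rewrite mxE => ->; apply: eq_bigr => k _; rewrite !mxE.
Qed.

Lemma Linfmx_conj n (U : 'M[A]_n) : Linfmx U -> Linfmx (opconj U).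
Proof. by move=> MU i j; rewrite mxE; exact: Linf_star. Qed.
Lemma Linfmx_ampl n (X : 'M[R[i]]_n) (U : 'M[A]_n) : Linfmx U -> Linfmx (amp X *m U).
Proof. by move=> MU i j; rewrite amp_mulmxE; exact: Linf_sum. Qed.
Lemma Linfmx_ampr n (X : 'M[R[i]]_n) (U : 'M[A]_n) : Linfmx U -> Linfmx (U *m amp X).
Proof. by move=> MU i j; rewrite mulmx_ampE; exact: Linf_sum. Qed.

Lemma tensmx_ampl n (X : 'M[R[i]]_n) (U V : 'M[A]_n) i j : Linfmx U -> Linfmx V ->
  tensmx (amp X *m U) V i j = \sum_k X i k *: tensmx U V k j.
Proof.
move=> MU MV; rewrite /tensmx.
under eq_bigr => k _ do rewrite amp_mulmxE tens2_suml //.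
by rewrite exchange_big; apply: eq_bigr => k _; rewrite scaler_sumr.
Qed.

Lemma tensmx_ampr n (Y : 'M[R[i]]_n) (U V : 'M[A]_n) i j : Linfmx U -> Linfmx V ->
  tensmx U (V *m amp Y) i j = \sum_k Y k j *: tensmx U V i k.
Proof.
move=> MU MV; rewrite /tensmx.
under eq_bigr => k _ do rewrite mulmx_ampE tens2_sumr //.
by rewrite exchange_big; apply: eq_bigr => k _; rewrite scaler_sumr.
Qed.

Lemma tensmx_amp_mid n (Y : 'M[R[i]]_n) (U V : 'M[A]_n) i j : Linfmx U -> Linfmx V ->
  tensmx (U *m amp Y) V i j = tensmx U (amp Y *m V) i j.
Proof.
move=> MU MV; rewrite /tensmx.
under eq_bigr => k _ do rewrite mulmx_ampE tens2_suml //.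
under [RHS]eq_bigr => k _ do rewrite amp_mulmxE tens2_sumr //.
by rewrite exchange_big.
Qed.

Lemma comul_sum I (r : seq I) (c : I -> R[i]) (a : I -> A) : (forall i, M (a i)) ->
  comul (\sum_(i <- r) c i *: a i : A) = \sum_(i <- r) c i *: comul (a i).
Proof.
move=> Ma; have [[_ lc _ _] _ _ _] := comulP G; rewrite opval_sum.
exact: (@linear_on_sum _ _ _ _ _ _ r c (fun i => opval (a i)) Linf_lin_closed lc).
Qed.

(** A left inverse of X suffices: it cancels in the middle of
    (X V Y)_13 (X V Y)_23. *)
Lemma repmx_conjugate n (X Y : 'M[R[i]]_n) (V : 'M[A]_n) :
  Y *m X = 1%:M -> repmx V -> repmx (amp X *m V *m amp Y).
Proof.
move=> YX [MV cV]; split=> [|i j]; first exact/Linfmx_ampr/Linfmx_ampl.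
rewrite tensmx_amp_mid; [|exact: Linfmx_ampl|exact/Linfmx_ampr/Linfmx_ampl].
rewrite !mulmxA -ampM YX amp1 mul1mx.
rewrite tensmx_ampr //; last exact: Linfmx_ampl.
rewrite mulmx_ampE comul_sum; last by move=> k; exact: Linfmx_ampl.
apply: eq_bigr => k _; congr (_ *: _).
rewrite tensmx_ampl // amp_mulmxE comul_sum //.
by apply: eq_bigr => l _; rewrite cV.
Qed.

(** The comultiplication preserves adjoints, so the image of u_ij^* is the adjoint
    of the sum of the u_ik (x) u_kj; on simple tensors that adjoint is the sum of
    the u_ik^* (x) u_kj^*. *)
Lemma repmx_contragredient n (U : 'M[A]_n) : repmx U -> repmx (opconj U).
Proof.
move=> [MU cU]; split=> [|i j]; first exact: Linfmx_conj.
have [[cM _ _ _] _ cstar _] := comulP G.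
have MV := Linfmx_conj MU.
have cadj : is_adjoint (comul (U i j)) (comul (opconj U i j)).
  by apply: cstar => //; rewrite mxE; exact: opstarP.
have bV k l k' l' : bounded_op (tens2 (opconj U k l) (opconj U k' l')).
  by have [] := tens2P (MV k l) (MV k' l').
apply: (bounded_op_eq_tens (tensP G)).
- by have [] := cM _ (MV i j).
- rewrite /tensmx -(eq_bigr _ (fun k _ => scale1r _)).
  exact: (@bounded_op_sum _ _ _ _ _ (fun=> 1) (fun k => tens2 (opconj U i k) (opconj U k j))).
move=> x y; apply/eqP; rewrite -subr_eq0; apply/eqP/(ortho_tens0 (tensP G)) => x' y'.
rewrite innerBl (is_adjoint_sym cadj) cU /tensmx !fct_sumE.
have -> : \sum_k tens2 (U i k) (U k j) (tens x' y') =
    \sum_k tens (U i k x') (U k j y').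
  by apply: eq_bigr => k _; have [_ ->] := tens2P (MU i k) (MU k j).
have -> : \sum_k tens2 (opconj U i k) (opconj U k j) (tens x y) =
    \sum_k tens (opconj U i k x) (opconj U k j y).
  by apply: eq_bigr => k _; have [_ ->] := tens2P (MV i k) (MV k j).
rewrite inner_suml inner_sumr; apply/eqP; rewrite subr_eq0; apply/eqP.
have [_ _ ti] := tb.
apply: eq_bigr => k _; rewrite !ti !mxE.
by rewrite (is_adjoint_sym (opstarP (U i k))) (is_adjoint_sym (opstarP (U k j))).
Qed.

End QuantumGroup.

(** * Averaging with the Haar state *)

Section Haar.
Context {R : realType} (G : compactQuantumGroup R).
Local Notation H := (qgH G).
Local Notation HH := (qgHH G).
Local Notation A := (adjop H).
Local Notation M := (@Linf R G).
Local Notation MM := (vn_tensor (@tens R G) M M).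
Local Notation C := R[i].
Implicit Types (a b : A) (n m p : nat).

Lemma vn_tensor_sum I (r : seq I) (a : I -> HH -> HH) :
  (forall i, MM (a i)) -> MM (\sum_(i <- r) a i).
Proof.
move=> Ma; rewrite -(eq_bigr _ (fun i _ => scale1r (a i))).
exact: (@lin_closed_sum _ _ _ _ r (fun=> 1) a (bicommutant_lin_closed _)).
Qed.

Lemma linear_on_vn_tensor_sum (V : lmodType C) (Phi : (HH -> HH) -> V) I (r : seq I)
    (a : I -> HH -> HH) :
  linear_on MM Phi -> (forall i, MM (a i)) ->
  Phi (\sum_(i <- r) a i) = \sum_(i <- r) Phi (a i).
Proof.
move=> lP Ma.
have := @linear_on_sum _ _ _ _ Phi _ r (fun=> 1) a (bicommutant_lin_closed _) lP Ma.
by rewrite -!(eq_bigr _ (fun i _ => esym (scale1r _))).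
Qed.

Lemma comul_mul n (U V : 'M[A]_n) i j i' j' : repmx U -> repmx V ->
  comul (U i j * V i' j' : A) =
    \sum_k \sum_l tens2 (U i k * V i' l) (U k j * V l j').
Proof.
move=> [MU cU] [MV cV]; have [_ cmul _ _] := comulP G.
rewrite opvalM cmul //.
apply/funext => z /=; rewrite cU cV /tensmx !fct_sumE.
apply: eq_bigr => k _; rewrite fct_sumE.
have [[lt _] _] := tens2P (MU i k) (MU k j).
pose f : {linear HH -> HH} := HB.pack (tens2 (U i k) (U k j)) (GRing.isLinear.Build _ _ _ _ _ lt).
rewrite -[LHS]/(f _) linear_sum; apply: eq_bigr => l _.
by rewrite -tens2_comp.
Qed.

Definition haarmx m n (X : 'M[A]_(m, n)) : 'M[C]_(m, n) := \matrix_(i, j) haar (X i j).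

Lemma haar_sum I (r : seq I) (c : I -> C) (a : I -> A) : (forall i, M (a i)) ->
  haar (\sum_(i <- r) c i *: a i : A) = \sum_(i <- r) c i * haar (a i).
Proof.
move=> Ma; have [lh _ _ _ _] := haarP G; rewrite opval_sum.
exact: (@linear_on_sum _ _ (R[i]^o) _ _ _ r c (fun i => opval (a i)) (Linf_lin_closed G) lh).
Qed.

Lemma haar_sum1 I (r : seq I) (a : I -> A) : (forall i, M (a i)) ->
  haar (\sum_(i <- r) a i : A) = \sum_(i <- r) haar (a i).
Proof.
move=> Ma; have := haar_sum r (fun=> 1) Ma.
under eq_bigr do rewrite scale1r.
by under [in RHS]eq_bigr do rewrite mul1r.
Qed.

Lemma comul_sum1 I (r : seq I) (a : I -> A) : (forall i, M (a i)) ->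
  comul (\sum_(i <- r) a i : A) = \sum_(i <- r) comul (a i).
Proof.
move=> Ma; have := comul_sum r (fun=> 1) Ma.
under eq_bigr do rewrite scale1r.
by under [in RHS]eq_bigr do rewrite scale1r.
Qed.

Lemma Linf_mulmx n (U V : 'M[A]_n) i j : Linfmx U -> Linfmx V -> M ((U *m V) i j).
Proof. by move=> MU MV; rewrite mxE; apply: Linf_sum1 => k; exact: LinfM. Qed.

Lemma Linfmx_tr n (U : 'M[A]_n) : Linfmx U -> Linfmx U^T.
Proof. by move=> MU i j; rewrite mxE. Qed.

(** Left invariance of the Haar state, applied to the entries of U^T V.  When V
    is the contragredient of U, U^T is the adjoint of V, and the identity says
    that V preserves the sesquilinear form with matrix (h (x) id)(V* V). *)
Lemma haar_averagel n (U V : 'M[A]_n) : repmx U -> repmx V ->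
  U^T *m amp (haarmx (U^T *m V)) *m V = amp (haarmx (U^T *m V)).
Proof.
move=> rU rV; have [[MU cU] [MV cV]] := (rU, rV).
have [E [[_ lE _ _] Etens Ecomul]] := haar_invl G.
apply/matrixP => i j; apply: opval_inj.
have -> : opval (amp (haarmx (U^T *m V)) i j) = E (comul ((U^T *m V) i j)).
  rewrite Ecomul ?[amp _ _ _]mxE ?[haarmx _ _ _]mxE //.
  by apply: Linf_mulmx => //; exact: Linfmx_tr.
have [[_ lc _ _] _ _ _] := comulP G.
have MUV k i1 j1 : M (U k i1 * V k j1) by exact: LinfM.
have -> : comul ((U^T *m V) i j) = \sum_k comul (U k i * V k j : A).
  by rewrite -comul_sum1 // mxE; under [in LHS]eq_bigr do rewrite mxE.
have MT k l q : MM (tens2 (U q k * V q l) (U k i * V l j)).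
  by apply: tens2_in; exact: LinfM.
have -> : E (\sum_k comul (U k i * V k j : A)) =
   \sum_q \sum_k \sum_l haar (U q k * V q l : A) *: opval (U k i * V l j).
  under eq_bigr => q _ do rewrite comul_mul //.
  rewrite linear_on_vn_tensor_sum //; last first.
    by move=> q; apply: vn_tensor_sum => k; exact: vn_tensor_sum.
  apply: eq_bigr => q _; rewrite linear_on_vn_tensor_sum //; last first.
    by move=> k; exact: vn_tensor_sum.
  apply: eq_bigr => k _; rewrite linear_on_vn_tensor_sum //.
  by apply: eq_bigr => l _; rewrite Etens //; exact: LinfM.
transitivity (\sum_k \sum_l haarmx (U^T *m V) k l *: opval (U k i * V l j)).
  rewrite mxE opval_sum [RHS]exchange_big; apply: eq_bigr => l _.
  rewrite mulmx_ampE mulr_suml opval_sum; apply: eq_bigr => k _.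
  by rewrite -opscaleAl [U^T _ _]mxE.
rewrite [RHS]exchange_big; apply: eq_bigr => k _.
rewrite [RHS]exchange_big; apply: eq_bigr => l _.
rewrite -scaler_suml; congr (_ *: _); rewrite [haarmx _ _ _]mxE [(U^T *m V) k l]mxE.
by rewrite -haar_sum1 //; under [in LHS]eq_bigr do rewrite mxE.
Qed.

(** The mirror image, from right invariance; its use is to produce a right
    inverse of V. *)
Lemma haar_averager n (U V : 'M[A]_n) : repmx U -> repmx V ->
  V *m amp (haarmx (V *m U^T)) *m U^T = amp (haarmx (V *m U^T)).
Proof.
move=> rU rV; have [[MU cU] [MV cV]] := (rU, rV).
have [E [[_ lE _ _] Etens Ecomul]] := haar_invr G.
apply/matrixP => i j; apply: opval_inj.
have -> : opval (amp (haarmx (V *m U^T)) i j) = E (comul ((V *m U^T) i j)).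
  rewrite Ecomul ?[amp _ _ _]mxE ?[haarmx _ _ _]mxE //.
  by apply: Linf_mulmx => //; exact: Linfmx_tr.
have MVU i1 j1 i2 j2 : M (V i1 j1 * U i2 j2) by exact: LinfM.
have -> : comul ((V *m U^T) i j) = \sum_k comul (V i k * U j k : A).
  by rewrite -comul_sum1 // mxE; under [in LHS]eq_bigr do rewrite mxE.
have MT k l q : MM (tens2 (V i k * U j l) (V k q * U l q)).
  by apply: tens2_in; exact: LinfM.
have -> : E (\sum_k comul (V i k * U j k : A)) =
   \sum_q \sum_k \sum_l haar (V k q * U l q : A) *: opval (V i k * U j l).
  under eq_bigr => q _ do rewrite comul_mul //.
  rewrite linear_on_vn_tensor_sum //; last first.
    by move=> q; apply: vn_tensor_sum => k; exact: vn_tensor_sum.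
  apply: eq_bigr => q _; rewrite linear_on_vn_tensor_sum //; last first.
    by move=> k; exact: vn_tensor_sum.
  apply: eq_bigr => k _; rewrite linear_on_vn_tensor_sum //.
  by apply: eq_bigr => l _; rewrite Etens //; exact: LinfM.
transitivity (\sum_k \sum_l haarmx (V *m U^T) k l *: opval (V i k * U j l)).
  rewrite mxE opval_sum [RHS]exchange_big; apply: eq_bigr => l _.
  rewrite mulmx_ampE mulr_suml opval_sum; apply: eq_bigr => k _.
  by rewrite -opscaleAl [U^T _ _]mxE.
rewrite [RHS]exchange_big; apply: eq_bigr => k _.
rewrite [RHS]exchange_big; apply: eq_bigr => l _.
rewrite -scaler_suml; congr (_ *: _); rewrite [haarmx _ _ _]mxE [(V *m U^T) k l]mxE.
by rewrite -haar_sum1 //; under [in LHS]eq_bigr do rewrite mxE.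
Qed.

Lemma haar0 : haar (0 : A) = 0.
Proof.
by have := haar_sum1 (a := fun i : 'I_0 => (0 : A)) [::]; rewrite !big_nil; apply => -[].
Qed.

Lemma haarZ (c : C) a : M a -> haar (c *: a : A) = c * haar a.
Proof.
by move=> Ma; have := haar_sum [:: tt] (fun=> c) (fun=> Ma); rewrite !big_seq1.
Qed.

Lemma haarD a b : M a -> M b -> haar (a + b : A) = haar a + haar b.
Proof.
move=> Ma Mb; have := @haar_sum1 _ [:: true; false] (fun c => if c then a else b).
by rewrite !big_cons !big_nil !addr0; apply => -[].
Qed.

Lemma Linf_id : M (1 : A).
Proof. by rewrite -LinfE; split; [exact: bounded_op_id|]. Qed.

Lemma haar_star_ge0 a : M a -> 0 <= haar (opstar a * a : A).
Proof.
move=> Ma; have [_ h0 _ _ _] := haarP G; apply: h0.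
  by apply: LinfM => //; exact: Linf_star.
move=> x; rewrite opvalM /= -[adjoint a]/(opval (opstar a)).
by rewrite (is_adjoint_sym (opstarP a)) inner_ge0.
Qed.

Lemma haar_star_eq0 a : M a -> haar (opstar a * a : A) = 0 -> a = 0.
Proof.
move=> Ma; have [_ _ _ h0 _] := haarP G => e.
have sa : forall x, inner ((opstar a * a : A) x) x = inner (a x) (a x).
  move=> x; rewrite opvalM /= -[adjoint a]/(opval (opstar a)).
  by rewrite (is_adjoint_sym (opstarP a)).
have : opval (opstar a * a) = (fun=> 0).
  apply: h0 => //; first by apply: LinfM => //; exact: Linf_star.
  by move=> x; rewrite sa inner_ge0.
move=> e0; apply: adjopE => x; apply: inner_eq0.
by rewrite -sa e0 inner0l.
Qed.

(** A positive functional is hermitian: h((a + c)* (a + c)) is real for every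
    scalar c, and c = 1 and c = i decide. *)
Lemma haar_opstar a : M a -> haar (opstar a) = (haar a)^*.
Proof.
move=> Ma; have Ms := Linf_star Ma; have M1 := Linf_id.
have [_ _ h1 _ _] := haarP G.
have MZ c b : M b -> M (c *: b : A).
  by move=> Mb; have := Linf_sum [:: tt] (fun=> c) (fun=> Mb); rewrite big_seq1.
have MD b (d : A) : M b -> M d -> M (b + d : A).
  move=> Mb Md; have := @Linf_sum1 _ _ _ [:: true; false] (fun c => if c then b else d).
  by rewrite !big_cons !big_nil !addr0; apply => -[].
have real c : c * haar (opstar a) + c^* * haar a \is Num.real.
  have hE : haar (opstar (a + c *: (1 : A)) * (a + c *: (1 : A)) : A) =
      haar (opstar a * a : A) + c^* * c + (c * haar (opstar a) + c^* * haar a).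
    rewrite opstarD opstarZ opstar1 mulrDl !mulrDr -!opscaleAl -!opscaleAr !mulr1 !mul1r.
    have m1 := MZ c _ M1; have m2 := MZ c^* _ m1; have m3 := MZ c^* _ Ma.
    have m4 := MD _ _ m3 m2; have m5 := MZ c _ Ms; have m6 := LinfM Ms Ma.
    have m7 := MD _ _ m6 m5.
    rewrite !(haarD, haarZ) //.
    by rewrite opval1 h1; ring.
  have := haar_star_ge0 (MD _ _ Ma (MZ c _ M1)); rewrite hE => /ger0_real.
  rewrite rpredDl // rpredD // ger0_real ?haar_star_ge0 //.
  by rewrite mulrC -normCK exprn_ge0.
have h2 c : c^* * (haar (opstar a))^* + c * (haar a)^* =
    c * haar (opstar a) + c^* * haar a.
  by have /CrealP e := real c; rewrite -[RHS]e rmorphD !rmorphM /= conjCK.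
have := h2 'i; have := h2 1; rewrite conjC1 !mul1r conjCi => e1 ei.
have {}ei : - (haar (opstar a))^* + (haar a)^* = haar (opstar a) - haar a.
  apply: (mulfI (neq0Ci C)); move: ei; rewrite !mulrDr !mulNr !mulrN => ->; done.
have h4 : haar (opstar a) * 2 = (haar a)^* * 2.
  have -> : haar (opstar a) * 2 =
    (haar (opstar a) + haar a) + (haar (opstar a) - haar a) by ring.
  by rewrite -e1 -ei; ring.
by apply: (mulIf _ h4); rewrite pnatr_eq0.
Qed.

(** As haar 1 = 1, the identity operator is not zero. *)
Lemma amp_eq0 m n (X : 'M[C]_(m, n)) : amp X = 0 :> 'M[A]_(m, n) -> X = 0.
Proof.
move=> e; have [_ _ h1 _ _] := haarP G.
apply/matrixP => i j; rewrite mxE.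
have : haar (amp X i j : A) = X i j.
  by rewrite mxE haarZ ?opval1 ?h1 ?mulr1 //; exact: Linf_id.
by rewrite e mxE => <-; exact: haar0.
Qed.

Lemma haarmx_amp m n (X : 'M[C]_(m, n)) (U : 'M[A]_n) p (Y : 'M[C]_(n, p)) : Linfmx U ->
  haarmx (amp X *m U *m amp Y) = X *m haarmx U *m Y.
Proof.
move=> MU; apply/matrixP => i j; rewrite mxE mulmx_ampE haar_sum; last first.
  by move=> k; rewrite amp_mulmxE; exact: Linf_sum.
rewrite mxE; apply: eq_bigr => k _; rewrite mulrC; congr (_ * _).
rewrite amp_mulmxE haar_sum // mxE.
by apply: eq_bigr => l _; rewrite mxE.
Qed.

Lemma haarmx_col_ge0 n (z : 'cV[A]_n) : (forall i, M (z i 0)) ->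
  0 <= haarmx (opadj z *m z) 0 0.
Proof.
move=> Mz; rewrite mxE mxE haar_sum1; last first.
  by move=> k; rewrite !mxE; apply: LinfM => //; exact: Linf_star.
by apply: sumr_ge0 => k _; rewrite !mxE haar_star_ge0.
Qed.

Lemma haarmx_col_eq0 n (z : 'cV[A]_n) : (forall i, M (z i 0)) ->
  haarmx (opadj z *m z) 0 0 = 0 -> z = 0.
Proof.
move=> Mz; rewrite mxE mxE haar_sum1; last first.
  by move=> k; rewrite !mxE; apply: LinfM => //; exact: Linf_star.
move=> /psumr_eq0P h; apply/matrixP => i j; rewrite [j]ord1 [RHS]mxE.
apply: haar_star_eq0 => //; have := h _ i isT; rewrite !mxE; apply.
by move=> k _; rewrite !mxE haar_star_ge0.
Qed.

End Haar.

(** * Complex matrices *)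

Section ComplexMatrices.
Context {C : numClosedFieldType}.
Implicit Types m n p : nat.

Lemma adjmxM m n p (X : 'M[C]_(m, n)) (Y : 'M[C]_(n, p)) :
  (X *m Y) ^t* = Y ^t* *m X ^t*.
Proof. by rewrite trmx_mul map_mxM. Qed.

Lemma conjmx_inj m n : injective (@map_mx C C Num.conj m n).
Proof.
move=> X Y e; apply/matrixP => i j; apply: (can_inj (@conjCK C)).
by move/matrixP: e => /(_ i j); rewrite !mxE.
Qed.

Lemma unitmx_row_inj n (X : 'M[C]_n) :
  (forall x : 'rV_n, x *m X = 0 -> x = 0) -> X \in unitmx.
Proof.
move=> h; rewrite -row_free_unit -kermx_eq0; apply/eqP/row_matrixP => i.
by rewrite row0; apply: h; rewrite -row_mul mulmx_ker row0.
Qed.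

Lemma unitmx_col_inj n (X : 'M[C]_n) :
  (forall x : 'cV_n, X *m x = 0 -> x = 0) -> X \in unitmx.
Proof.
move=> h; rewrite -unitmx_tr; apply: unitmx_row_inj => x xX.
apply: trmx_inj; rewrite trmx0; apply: h.
by rewrite -[X]trmxK -trmx_mul xX trmx0.
Qed.

Lemma mulmx_adj_ge0 n (x : 'rV[C]_n) : 0 <= (x *m x ^t*) 0 0.
Proof. by rewrite mxE sumr_ge0 // => i _; rewrite !mxE -normCK exprn_ge0. Qed.

Lemma mulmx_adj_eq0 n (x : 'rV[C]_n) : (x *m x ^t*) 0 0 = 0 -> x = 0.
Proof.
rewrite mxE => /psumr_eq0P h; apply/rowP => i; rewrite [RHS]mxE.
have /eqP : x 0 i * x ^t* i 0 = 0.
  by apply: h => // j _; rewrite !mxE -normCK exprn_ge0.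
by rewrite !mxE -normCK expf_eq0 normr_eq0 => /eqP.
Qed.

(** The orthogonal projection onto the range of r is r r* N^-1 with
    N = r r* + (1 - r)* (1 - r), which is positive definite and commutes with
    r r*. *)
Lemma idempotent_range_proj n (r : 'M[C]_n) : r *m r = r ->
  exists p : 'M[C]_n, [/\ p *m p = p, p ^t* = p, p *m r = r & r *m p = p].
Proof.
move=> rr; pose s := r ^t*; pose q := 1%:M - r; pose N := r *m s + q ^t* *m q.
have qr : q *m r = 0 by rewrite mulmxBl mul1mx rr subrr.
have sq : s *m q ^t* = 0 by rewrite -adjmxM qr trmx0 map_mx0.
have qE : q ^t* = 1%:M - s by rewrite /q linearB /= map_mxB trmx1 map_mx1.
have Nu : N \in unitmx.
  apply: unitmx_row_inj => x xN.
  have : (x *m N *m x ^t*) 0 0 = 0 by rewrite xN mul0mx mxE.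
  have -> : x *m N *m x ^t* = (x *m r) *m (x *m r) ^t* + (x *m q ^t*) *m (x *m q ^t*) ^t*.
    by rewrite !adjmxM trmxCK mulmxDr mulmxDl !mulmxA.
  rewrite mxE => /eqP; rewrite paddr_eq0 ?mulmx_adj_ge0 //.
  move=> /andP[/eqP/mulmx_adj_eq0 xr /eqP/mulmx_adj_eq0].
  rewrite qE mulmxBr mulmx1 => /eqP; rewrite subr_eq0 => /eqP xs.
  apply: mulmx_adj_eq0; rewrite {1}xs -mulmxA -adjmxM xr trmx0 map_mx0 mulmx0.
  by rewrite mxE.
have Nr : N *m r = r *m s *m r by rewrite mulmxDl -[q ^t* *m q *m r]mulmxA qr mulmx0 addr0.
have comm : N *m (r *m s) = r *m s *m N.
  rewrite mulmxA Nr [RHS]mulmxDr [r *m s *m (_ *m q)]mulmxA.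
  by rewrite -[r *m s *m q ^t*]mulmxA sq mulmx0 mul0mx addr0 !mulmxA.
pose p := r *m s *m invmx N.
have pE : p = invmx N *m (r *m s).
  by rewrite /p -[LHS](mulKmx Nu) [N *m _]mulmxA comm mulmxK.
have pr : p *m r = r by rewrite pE -mulmxA -Nr mulKmx.
have rp : r *m p = p by rewrite /p !mulmxA rr.
exists p; split=> //; first by rewrite {2}/p !mulmxA pr.
have Ns : N ^t* = N.
  by rewrite linearD /= map_mxD !adjmxM !trmxCK.
rewrite {1}/p !adjmxM trmxCK pE; congr (_ *m _).
by rewrite trmx_inv map_invmx Ns.
Qed.

(** By the spectral theorem; X is a diagonal square root times the unitary that
    diagonalizes E. *)
Lemma gram_sqrt n (E : 'M[C]_n) : E ^t* = E -> E \in unitmx ->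
  (forall x : 'cV_n, 0 <= (x ^t* *m E *m x) 0 0) ->
  exists2 X : 'M[C]_n, X \in unitmx & X ^t* *m X = E.
Proof.
move=> Eh Eu Epos.
have /orthomx_spectralP : E \is normalmx by apply/normalmxP; rewrite Eh.
set P := spectralmx E; set d := spectral_diag E.
have Pu : P \is unitarymx := spectral_unitarymx E.
rewrite (invmx_unitary Pu) => EE.
have d0 i : 0 <= d 0 i.
  have := Epos ((row i P) ^t*); rewrite trmxCK {1}EE.
  have PP : P *m P ^t* = 1%:M by apply/unitarymxP.
  have -> : row i P *m (P ^t* *m diag_mx d *m P) *m (row i P) ^t* =
      row i (P *m P ^t*) *m diag_mx d *m (row i (P *m P ^t*)) ^t*.
    by rewrite !row_mul adjmxM trmxCK !mulmxA.
  rewrite PP row1 mul_mx_diag mxE (bigD1 i) //= big1 => [|k ki].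
    by rewrite !mxE !eqxx conjC1 mulr1 mul1r addr0.
  by rewrite !mxE eqxx /= (negPf ki) conjC0 mulr0.
pose X := diag_mx (\row_i sqrtC (d 0 i)) *m P.
have XX : X ^t* *m X = E.
  rewrite /X adjmxM tr_diag_mx map_diag_mx -mulmxA [diag_mx _ *m (_ *m _)]mulmxA.
  rewrite mulmx_diag mulmxA [RHS]EE; congr (_ *m diag_mx _ *m _).
  apply/rowP => i; rewrite !mxE.
  have /ger0_real/CrealP : 0 <= sqrtC (d 0 i) by rewrite sqrtC_ge0.
  by move=> /= ->; rewrite -expr2 sqrtCK.
by exists X => //; move: Eu; rewrite -XX unitmx_mul => /andP[].
Qed.

End ComplexMatrices.

(** * Irreducibility and Schur's lemma *)

Section Irreducible.
Context {R : realType} {H : hilbertType R}.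
Local Notation A := (adjop H).
Local Notation C := R[i].
Implicit Types n : nat.

Definition irrmx n (U : 'M[A]_n) := (0 < n)%N /\
  forall p : 'M[C]_n, p *m p = p -> p ^t* = p ->
    amp p *m (U *m amp p) = U *m amp p -> p = 0 \/ p = 1%:M.

Definition unitarymx_op n (U : 'M[A]_n) :=
  opadj U *m U = 1%:M /\ U *m opadj U = 1%:M.

(** Irreducibility is phrased with orthogonal projections, while conjugation by
    an invertible matrix only preserves idempotents; the range of an idempotent
    decides whether it is invariant. *)
Lemma irrmx_idempotent n (U : 'M[A]_n) (r : 'M[C]_n) : irrmx U -> r *m r = r ->
  amp r *m U *m amp r = U *m amp r -> r = 0 \/ r = 1%:M.
Proof.
move=> [_ irr] rr rU; have [p [pp ph pr rp]] := idempotent_range_proj rr.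
have Up : amp p *m (U *m amp p) = U *m amp p.
  have e : U *m amp p = amp r *m (U *m amp p).
    by rewrite -rp ampM !mulmxA rU.
  by rewrite {1}e mulmxA -ampM pr -e.
have [p0|p1] := irr p pp ph Up; [left|right].
  by rewrite -pr p0 mul0mx.
by rewrite -(mulmx1 r) -p1 rp.
Qed.

Lemma amp_scalarC n (l : C) (U : 'M[A]_n) : amp l%:M *m U = U *m amp l%:M.
Proof.
apply/matrixP => i j; rewrite amp_mulmxE mulmx_ampE.
rewrite (bigD1 i) //= big1 => [|k ki]; last by rewrite !mxE eq_sym (negPf ki) scale0r.
rewrite (bigD1 j) //= big1 => [|k ki]; last by rewrite !mxE (negPf ki) scale0r.
by rewrite !mxE !eqxx.
Qed.

(** For an eigenvalue l of T the kernel of T - l is a nonzero invariant subspace;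
    1 - N^+ N, with N^+ a generalized inverse of N = T - l, is an idempotent with
    that range. *)
Lemma schur_lemma n (U : 'M[A]_n) (T : 'M[C]_n) : irrmx U ->
  amp T *m U = U *m amp T -> exists l, T = l%:M.
Proof.
move=> irr TU; have [n0 _] := irr.
have [l lT] := eigenvalue_closed T n0.
pose N := T - l%:M.
have [r rE] : exists r, r = 1%:M - pinvmx N *m N by eexists.
have Nr : N *m r = 0 by rewrite rE mulmxBr mulmx1 mulmxA mulmxKpV // subrr.
have rr : r *m r = r by rewrite {1}rE mulmxBl mul1mx -mulmxA Nr mulmx0 subr0.
have lU := amp_scalarC l U.
have NU : amp N *m U = U *m amp N by rewrite ampB mulmxBl mulmxBr TU lU.
have rU : amp r *m U *m amp r = U *m amp r.
  rewrite {1}rE ampB amp1 !mulmxBl mul1mx ampM -[X in _ - X]mulmxA -[X in _ - X]mulmxA.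
  by rewrite [amp N *m _]mulmxA NU -mulmxA -ampM Nr amp0 !mulmx0 subr0.
exists l; apply/eqP; rewrite -subr_eq0 -/N; apply/eqP.
have [r0|r1] := irrmx_idempotent irr rr rU; last by rewrite -[LHS]mulmx1 -r1.
have NN : pinvmx N *m N = 1%:M by apply/esym/eqP; rewrite -subr_eq0 -rE r0.
have [v vT v0] := eigenvalueP lT.
have vN : v *m N = 0 by rewrite mulmxBr vT mul_mx_scalar subrr.
by case/eqP: v0; rewrite -[v]mulmx1 -(mulmx1C NN) mulmxA vN mul0mx.
Qed.

End Irreducible.

(** * The contragredient is unitarizable *)

Section Contragredient.
Context {R : realType} (G : compactQuantumGroup R).
Local Notation H := (qgH G).
Local Notation A := (adjop H).
Local Notation M := (@Linf R G).
Local Notation C := R[i].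
Implicit Types n : nat.

Lemma Linfmx_mul n (U V : 'M[A]_n) : Linfmx U -> Linfmx V -> Linfmx (U *m V).
Proof. by move=> MU MV i j; exact: Linf_mulmx. Qed.

Lemma Linfmx_adj n (U : 'M[A]_n) : Linfmx U -> Linfmx (opadj U).
Proof. by move=> MU; apply: Linfmx_tr; exact: Linfmx_conj. Qed.

Lemma haarmx_adj n (U : 'M[A]_n) : Linfmx U -> (haarmx U) ^t* = haarmx (opadj U).
Proof. by move=> MU; apply/matrixP => i j; rewrite !mxE haar_opstar. Qed.

Lemma haarmx_gram_ge0 n (V : 'M[A]_n) (x : 'cV[C]_n) : Linfmx V ->
  0 <= (x ^t* *m haarmx (opadj V *m V) *m x) 0 0.
Proof.
move=> MV; rewrite -haarmx_amp; last by apply: Linfmx_mul => //; exact: Linfmx_adj.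
rewrite -opadj_amp mulmxA -mulmxA -opadjM; apply: haarmx_col_ge0 => i.
by rewrite mulmx_ampE; exact: Linf_sum.
Qed.

Lemma haarmx_gram_eq0 n (V : 'M[A]_n) (x : 'cV[C]_n) : Linfmx V ->
  haarmx (opadj V *m V) *m x = 0 -> V *m amp x = 0.
Proof.
move=> MV e; apply: (haarmx_col_eq0 (z := V *m amp x)) => [i|].
  by rewrite mulmx_ampE; exact: Linf_sum.
rewrite opadjM -mulmxA [opadj V *m _]mulmxA mulmxA opadj_amp haarmx_amp.
  by rewrite -mulmxA e mulmx0 mxE.
by apply: Linfmx_mul => //; exact: Linfmx_adj.
Qed.

Section UnitaryRep.
Context {n : nat} (U : 'M[A]_n).
Hypotheses (rU : repmx U) (uU : unitarymx_op U).
Let V := opconj U.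
Let MU : Linfmx U. Proof. by case: rU. Qed.
Let rV : repmx V. Proof. exact: repmx_contragredient. Qed.
Let MV : Linfmx V. Proof. by case: rV. Qed.
Let VE : opadj V = U^T. Proof. by rewrite /opadj /V opconjK. Qed.
Let E := haarmx (opadj V *m V).
Let F := haarmx (V *m opadj V).

Let E_inv : opadj V *m amp E *m V = amp E.
Proof. by rewrite /E VE haar_averagel. Qed.
Let F_inv : V *m amp F *m opadj V = amp F.
Proof. by rewrite /F VE haar_averager. Qed.
Let E_unit : E \in unitmx.
Proof.
apply: unitmx_col_inj => x /(haarmx_gram_eq0 MV)/(congr1 (@opconj _ _ _ _)).
rewrite opconj_ampr /V opconjK => /(congr1 (mulmx (opadj U))).
have -> : opconj (0 : 'cV[A]_n) = 0 by apply/matrixP => i j; rewrite !mxE opstar0.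
rewrite mulmxA uU.1 mul1mx mulmx0 => /amp_eq0 x0.
by apply: conjmx_inj; rewrite x0 map_mx0.
Qed.
Let F_unit : F \in unitmx.
Proof.
apply: unitmx_row_inj => x xF.
have MV' := Linfmx_adj MV.
have Fh : F ^t* = F.
  by rewrite /F haarmx_adj ?opadjM ?opadjK //; exact: Linfmx_mul.
have : haarmx (opadj (opadj V) *m opadj V) *m x ^t* = 0.
  by rewrite opadjK -/F -Fh -adjmxM xF trmx0 map_mx0.
move=> /(haarmx_gram_eq0 MV'); rewrite VE.
rewrite -map_trmx -tr_ampl => /(congr1 trmx); rewrite trmxK trmx0.
move=> /(congr1 (mulmx^~ (opadj U))); rewrite -mulmxA uU.2 mulmx1 mul0mx => /amp_eq0 x0.
by apply: conjmx_inj; rewrite x0 map_mx0.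
Qed.

(** V preserves the form E, so W = X V X^-1 is an isometry when X* X = E.  An
    isometry over an infinite-dimensional algebra need not be unitary; here W has
    a right inverse because V F V* = F with F invertible. *)
Lemma contragredient_unitarizable : exists (X : 'M[C]_n) (E : 'M[C]_n),
  [/\ X \in unitmx, X ^t* *m X = E, opadj V *m amp E *m V = amp E &
    unitarymx_op (amp X *m V *m amp (invmx X))].
Proof.
have Eh : E ^t* = E.
  rewrite /E haarmx_adj ?opadjM ?opadjK //.
  by apply: Linfmx_mul => //; exact: Linfmx_adj.
have [X Xu XE] := gram_sqrt Eh E_unit (fun x => haarmx_gram_ge0 x MV).
exists X, E; split=> //.
set Y := invmx X; set W := amp X *m V *m amp Y.
have aXY : amp X *m amp Y = 1%:M :> 'M[A]_n by rewrite -ampM mulmxV // amp1.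
have aYX : amp Y *m amp X = 1%:M :> 'M[A]_n by rewrite -ampM mulVmx // amp1.
have WW : opadj W *m W = 1%:M.
  rewrite /W !opadjM !opadj_amp !mulmxA.
  rewrite -[_ *m amp (X ^t*) *m amp X]mulmxA -ampM XE.
  rewrite -[amp _ *m opadj V *m amp E]mulmxA -[amp _ *m (_ *m _) *m V]mulmxA E_inv -ampM.
  rewrite -XE mulmxA -adjmxM mulmxV // trmx1 map_mx1 mul1mx.
  exact: aXY.
have [Z VZ] : exists Z, V *m Z = 1%:M.
  exists (amp F *m opadj V *m amp (invmx F)).
  by rewrite !mulmxA F_inv -ampM mulmxV // amp1.
have WR : W *m (amp X *m Z *m amp Y) = 1%:M.
  rewrite /W !mulmxA -[amp X *m V *m amp Y *m amp X]mulmxA aYX mulmx1.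
  by rewrite -[amp X *m V *m Z]mulmxA VZ mulmx1 aXY.
split=> //.
by rewrite -[opadj W]mulmx1 -WR [opadj W *m _]mulmxA WW mul1mx WR.
Qed.

(** A projection invariant under X V X^-1 yields an idempotent invariant under V,
    and its complex conjugate one invariant under u. *)
Lemma irrmx_conjugate (X : 'M[C]_n) : irrmx U -> X \in unitmx ->
  irrmx (amp X *m V *m amp (invmx X)).
Proof.
move=> irr Xu; split=> [|p pp ph pW]; first by case: irr.
set Y := invmx X in pW *; have XY : X *m Y = 1%:M by rewrite mulmxV.
have YX : Y *m X = 1%:M by rewrite mulVmx.
pose r := Y *m p *m X.
have rr : r *m r = r.
  by rewrite /r !mulmxA -[_ *m p *m X *m Y]mulmxA XY mulmx1 -[Y *m p *m p]mulmxA pp.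
have rV' : amp r *m V *m amp r = V *m amp r.
  have Vr : V *m amp r = amp Y *m (amp X *m V *m amp Y *m amp p) *m amp X.
    by rewrite !mulmxA -ampM YX amp1 mul1mx /r !ampM !mulmxA.
  rewrite -mulmxA Vr -pW /r !ampM !mulmxA.
  rewrite -[_ *m amp p *m amp X *m amp Y]mulmxA -[amp X *m amp Y]ampM XY amp1 mulmx1.
  by rewrite -[amp Y *m amp p *m amp p]mulmxA -[amp p *m amp p]ampM pp.
have : map_mx Num.conj r = 0 \/ map_mx Num.conj r = 1%:M.
  apply: (irrmx_idempotent irr); first by rewrite -map_mxM rr.
  by have := congr1 (@opconj _ _ _ _) rV'; rewrite !opconj_ampr opconj_ampl /V opconjK.
have pr : p = X *m r *m Y by rewrite /r !mulmxA XY mul1mx -mulmxA XY mulmx1.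
case=> [r0|r1]; [left|right].
  rewrite pr; have -> : r = 0 by apply: conjmx_inj; rewrite r0 map_mx0.
  by rewrite mulmx0 mul0mx.
rewrite pr; have -> : r = 1%:M by apply: conjmx_inj; rewrite r1 map_mx1.
by rewrite mulmx1.
Qed.

End UnitaryRep.

Lemma irrmxP n (U : 'M[A]_n) : irrmx U <-> irreducible (opmx U).
Proof.
split=> -[n0 h]; split=> // p pp ph; have := h p pp ph; rewrite -!opmx_ampE -!opmxM.
  by move=> k /opmx_inj.
by move=> k e; apply: k; rewrite e.
Qed.

Lemma unitary_repP n (U : 'M[A]_n) :
  unitary_rep (opmx U) <-> repmx U /\ unitarymx_op U.
Proof.
split=> [[/repmxP rU u1 u2]|[rU [u1 u2]]].
  split=> //; split; apply: opmx_inj.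
    by rewrite opmxM opmx_opadj u1 -opmx_ampE amp1.
  by rewrite opmxM opmx_opadj u2 -opmx_ampE amp1.
split; first exact/repmxP.
  by rewrite -opmx_opadj -opmxM u1 -opmx_ampE amp1.
by rewrite -opmx_opadj -opmxM u2 -opmx_ampE amp1.
Qed.

(** * The antipode determines Q *)

Lemma Pol_coef n (W : 'M[A]_n) i j : irreducible_unitary (opmx W) -> @Pol R G (W i j).
Proof.
move=> hW; exists 1%N, (fun=> 1), (fun=> opval (W i j)); split.
  by move=> _; exists n, (opmx W), i, j; split => //; rewrite mxE.
by rewrite big_ord1 scale1r.
Qed.

Lemma Pol_lin_closed : lin_closed (@Pol R G).
Proof.
split.
  by exists 0%N, (fun=> 0), (fun=> 0); split => [[]//|]; rewrite big_ord0.
move=> c a a' [m [k [b [hb ->]]]] [m' [k' [b' [hb' ->]]]].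
exists (m + m')%N.
exists (fun i : 'I_(m + m') => match fintype.split i with inl j => c * k j | inr j => k' j end).
exists (fun i : 'I_(m + m') => match fintype.split i with inl j => b j | inr j => b' j end).
split=> [i|]; first by case: (fintype.split i).
have sl (j : 'I_m) : fintype.split (lshift m' j) = inl j := unsplitK (inl j).
have sr (j : 'I_m') : fintype.split (rshift m j) = inr j := unsplitK (inr j).
rewrite big_split_ord /= scaler_sumr.
by congr (_ + _); apply: eq_bigr => j _; rewrite ?sl ?sr ?scalerA.
Qed.

(** If two conjugations of u agree, the quotient of the conjugators commutes
    with u. *)
Lemma conjugations_agree n (k k' q q' u : 'M[A]_n) : k' *m k = 1%:M ->
  q' *m q = 1%:M -> q *m (u *m q') = k *m u *m k' -> k' *m q *m u = u *m (k' *m q).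
Proof.
move=> k'k q'q e.
have -> : k' *m q *m u = k' *m (q *m (u *m q')) *m q.
  by rewrite !mulmxA -[_ *m q' *m q]mulmxA q'q mulmx1.
by rewrite e !mulmxA k'k mul1mx.
Qed.

(** Writing V = X^-1 W X with W irreducible unitary gives S on the entries of V,
    hence S^2(u) = K u K^-1 with K = X^T conj(X) = E^T.  Schur's lemma makes Q a
    multiple of K; being diagonal, it is the same multiple of E, and V* E V = E. *)
Lemma modular_mx_invariant S n (U : 'M[A]_n) (Q : 'M[C]_n) : antipode S ->
  irreducible_unitary (opmx U) -> modular_mx S (opmx U) Q -> is_diag_mx Q ->
  opadj (opconj U) *m amp Q *m opconj U = amp Q.
Proof.
move=> [Slin Sirr] hU [_ Qu _ S2] Qd; have [/unitary_repP[rU uU] /irrmxP irr] := hU.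
have [X [E [Xu XE Einv Wu]]] := contragredient_unitarizable rU uU.
set V := opconj U in Einv Wu *; set Y := invmx X in Wu; set W := amp X *m V *m amp Y in Wu.
have XY : X *m Y = 1%:M by rewrite mulmxV.
have YX : Y *m X = 1%:M by rewrite mulVmx.
have hW : irreducible_unitary (opmx W).
  split; last by apply/irrmxP; exact: irrmx_conjugate.
  apply/unitary_repP; split=> //.
  by apply: repmx_conjugate => //; exact: repmx_contragredient.
have VW : V = amp Y *m W *m amp X.
  by rewrite /W !mulmxA -ampM YX amp1 mul1mx -mulmxA -ampM YX amp1 mulmx1.
have S1 i j : S (U i j) = V j i.
  by have := Sirr _ _ hU i j; rewrite !mxE.
have SW i j : S (W i j) = opstar (W j i).
  by have := Sirr _ _ hW i j; rewrite !mxE.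
have SV i j : S (V i j) = \sum_k X k j *: \sum_l Y i l *: opval (opstar (W k l)).
  rewrite VW mulmx_ampE opval_sum.
  rewrite (@linear_on_sum _ _ _ _ _ _ _ _ (fun k => opval ((amp Y *m W) i k)) Pol_lin_closed Slin).
    apply: eq_bigr => k _; congr (_ *: _); rewrite amp_mulmxE opval_sum.
    rewrite (@linear_on_sum _ _ _ _ _ _ _ _ (fun l => opval (W l k)) Pol_lin_closed Slin).
      by apply: eq_bigr => l _; rewrite SW.
    by move=> l; exact: Pol_coef.
  move=> k; rewrite amp_mulmxE opval_sum.
  apply: (@lin_closed_sum _ _ _ _ _ _ (fun l => opval (W l k)) Pol_lin_closed) => l.
  exact: Pol_coef.
have S2' : amp Q *m (U *m amp (invmx Q)) = amp X^T *m opconj W *m amp Y^T.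
  apply: opmx_inj; rewrite !opmxM !opmx_ampE -S2; apply/matrixP => i j.
  rewrite -!opmx_ampE -!opmxM [LHS]mxE /= [opmx U i j]mxE S1 SV [RHS]mxE.
  rewrite mulmx_ampE opval_sum.
  under [LHS]eq_bigr => k _ do rewrite scaler_sumr.
  rewrite exchange_big; apply: eq_bigr => l _.
  rewrite opvalZ amp_mulmxE opval_sum scaler_sumr; apply: eq_bigr => k _.
  by rewrite opvalZ !scalerA [Y^T _ _]mxE [X^T _ _]mxE mulrC [opconj W _ _]mxE.
have WX : opconj W = amp (map_mx Num.conj X) *m U *m amp (map_mx Num.conj Y).
  by rewrite /W opconj_ampr opconj_ampl /V opconjK.
pose K := X^T *m map_mx Num.conj X; pose K' := map_mx Num.conj Y *m Y^T.
have KE : K = E^T by rewrite /K -XE trmx_mul map_trmx trmxK.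
have K'K : K' *m K = 1%:M.
  rewrite /K /K' mulmxA -[_ *m Y^T *m X^T]mulmxA -trmx_mul XY trmx1 mulmx1.
  by rewrite -map_mxM YX map_mx1.
have KK' : K *m K' = 1%:M by exact: mulmx1C.
have QK : amp Q *m (U *m amp (invmx Q)) = amp K *m U *m amp K'.
  by rewrite S2' WX /K /K' !ampM !mulmxA.
have comm : amp (K' *m Q) *m U = U *m amp (K' *m Q).
  rewrite (ampM K' Q); apply: (conjugations_agree _ _ QK).
    by rewrite -ampM K'K amp1.
  by rewrite -ampM mulVmx // amp1.
have [l lE] := schur_lemma irr comm.
have QE : Q = E *m l%:M.
  have : K *m (K' *m Q) = K *m l%:M by rewrite lE.
  rewrite mulmxA KK' mul1mx mul_mx_scalar KE => e.
  have QT : Q^T = Q by have /diag_mxP[d ->] := Qd; exact: tr_diag_mx.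
  by rewrite -QT e linearZ /= trmxK mul_mx_scalar.
by rewrite QE ampM mulmxA -mulmxA amp_scalarC mulmxA Einv.
Qed.

End Contragredient.

(** * Norms of operator matrices *)

Section PowerLemma.
Context {R : realType}.

Lemma bernoulli_ineq (d : R) m : 0 <= d -> 1 + d *+ m <= (1 + d) ^+ m.
Proof.
move=> d0; elim: m => [|m IH]; first by rewrite mulr0n addr0 expr0.
rewrite exprS; apply: (le_trans _ (ler_wpM2l _ IH)); last by rewrite addr_ge0.
rewrite mulrDl mul1r mulrDr mulr1 mulrS addrA [d + d * _]addrC addrA.
rewrite -[leLHS]addrA [d + _]addrC addrA -[leRHS]addrA lerD2l lerDr.
by rewrite mulr_ge0 // mulrn_wge0.
Qed.

(** Comparing arbitrarily high powers absorbs any multiplicative constant. *)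
Lemma le_of_pow2_le (u v K : R) : 0 <= u -> 0 <= v ->
  (forall j, u ^+ (2 ^ j) <= K * v ^+ (2 ^ j)) -> u <= v.
Proof.
move=> u0 v0 h; rewrite leNgt; apply/negP => vu.
have u_gt0 : 0 < u by exact: le_lt_trans vu.
have [v0'|vN0] := eqVneq v 0.
  by have := h 0%N; rewrite expn0 !expr1 v0' mulr0 leNgt u_gt0.
have v_gt0 : 0 < v by rewrite lt_def vN0.
pose d := u / v - 1; have d0 : 0 < d by rewrite subr_gt0 ltr_pdivlMr // mul1r.
have uE : u = (1 + d) * v by rewrite /d addrC subrK divfK.
have K_ge j : 1 + d *+ (2 ^ j) <= K.
  apply: (le_trans (bernoulli_ineq _ (ltW d0))).
  by have := h j; rewrite {1}uE exprMn ler_pM2r // exprn_gt0.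
pose j := Num.bound (K / d).
have := K_ge j; rewrite leNgt => /negP; apply.
have : K / d < j%:R.
  apply: archi_boundP; rewrite divr_ge0 // ?(ltW d0) //.
  by rewrite (le_trans _ (K_ge 0%N)) // addr_ge0 // mulrn_wge0 // ltW.
rewrite ltr_pdivrMr // => Kj; apply: (lt_le_trans Kj).
rewrite mulr_natl; apply: (@le_trans _ _ (d *+ (2 ^ j))); last by rewrite lerDr.
by rewrite ler_pMn2l // ltnW // ltn_expl.
Qed.

End PowerLemma.

Section DirectSum.
Context {R : realType} {H : hilbertType R} {n : nat}.
Local Notation A := (adjop H).
Local Notation C := R[i].
Implicit Types (x y : 'I_n -> H) (T : 'M[A]_n).

Definition dsum_inner x y : C := \sum_i inner (x i) (y i).
Definition opmx_act T x : 'I_n -> H := fun i => \sum_j T i j (x j).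

Lemma dsum_inner_linearl y : linear (fun x => dsum_inner x y : C^o).
Proof.
move=> c x x'; rewrite /dsum_inner scaler_sumr -big_split; apply: eq_bigr => i _ /=.
by rewrite innerDl innerZl.
Qed.
Lemma dsum_innerC x y : dsum_inner y x = (dsum_inner x y)^*.
Proof. by rewrite /dsum_inner rmorph_sum; apply: eq_bigr => i _; exact: innerC. Qed.
Lemma dsum_inner_ge0 x : 0 <= dsum_inner x x.
Proof. by apply: sumr_ge0 => i _; exact: inner_ge0. Qed.
Lemma dsum_inner_eq0 x : dsum_inner x x = 0 -> x = 0.
Proof.
move=> /psumr_eq0P h; apply/funext => i; apply: inner_eq0.
by apply: h => // j _; exact: inner_ge0.
Qed.

Lemma norm_ReE (z : H) : `|z| = (complex.Re `|z|)%:C.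
Proof. by rewrite RRe_real // ger0_real. Qed.

Lemma dsum_norm_ge0 x : 0 <= dsum_norm x. Proof. exact: sqrtr_ge0. Qed.

Lemma dsum_inner_norm x : dsum_inner x x = (dsum_norm x ^+ 2)%:C.
Proof.
rewrite sqr_sqrtr; last by apply: sumr_ge0 => i _; exact: sqr_ge0.
rewrite /dsum_inner rmorph_sum; apply: eq_bigr => i _.
by rewrite inner_norm norm_ReE rmorphXn.
Qed.

Lemma dsum_norm_eq0 x : dsum_norm x = 0 -> x = 0.
Proof. by move=> e; apply: dsum_inner_eq0; rewrite dsum_inner_norm e expr0n. Qed.

Lemma dsum_CauchySchwarz x y : `|dsum_inner x y| <= (dsum_norm x * dsum_norm y)%:C.
Proof.
rewrite -(@ler_pXn2r _ 2) ?nnegrE ?normr_ge0 //; last first.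
  by rewrite lecR mulr_ge0 // dsum_norm_ge0.
rewrite [leRHS](_ : _ = dsum_inner x x * dsum_inner y y); last first.
  by rewrite !dsum_inner_norm -rmorphM -exprMn rmorphXn.
exact: (form_CauchySchwarz dsum_inner_linearl dsum_innerC dsum_inner_ge0 dsum_inner_eq0).
Qed.

Lemma opmx_act_mul T S x : opmx_act (T *m S) x = opmx_act T (opmx_act S x).
Proof.
apply/funext => i; rewrite /opmx_act.
under eq_bigr => j _ do rewrite mxE opval_sum fct_sumE.
rewrite exchange_big; apply: eq_bigr => k _ /=.
have lT := opval_linear (T i k).
pose f : {linear H -> H} := HB.pack (T i k : H -> H) (GRing.isLinear.Build _ _ _ _ _ lT).
by rewrite -[RHS]/(f _) linear_sum.
Qed.

Lemma opmx_act1 x : opmx_act 1%:M x = x.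
Proof.
apply/funext => i; rewrite /opmx_act (bigD1 i) //= big1 => [|j ji].
  by rewrite addr0 mxE eqxx.
by rewrite mxE eq_sym (negPf ji).
Qed.

Lemma dsum_inner_adj T x y : dsum_inner (opmx_act T x) y = dsum_inner x (opmx_act (opadj T) y).
Proof.
rewrite /dsum_inner /opmx_act; under eq_bigr => i _ do rewrite inner_suml.
rewrite exchange_big; apply: eq_bigr => j _; rewrite inner_sumr.
by apply: eq_bigr => i _; rewrite !mxE; exact: opstarP.
Qed.

Definition norm_le T (c : R) := forall x, dsum_norm (opmx_act T x) <= c * dsum_norm x.

Lemma norm_le_mul T S c d : 0 <= c -> norm_le T c -> norm_le S d ->
  norm_le (T *m S) (c * d).
Proof.
move=> c0 hT hS x; rewrite opmx_act_mul (le_trans (hT _)) // -mulrA ler_wpM2l //.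
Qed.

Lemma sq_dsum_norm_le x y z : dsum_inner x x = dsum_inner y z ->
  dsum_norm x ^+ 2 <= dsum_norm y * dsum_norm z.
Proof.
move=> e; rewrite -lecR -dsum_inner_norm e -[dsum_inner y z]ger0_norm ?dsum_CauchySchwarz //.
by rewrite -e dsum_inner_ge0.
Qed.

Lemma norm_le_adj T c : 0 <= c -> norm_le T c -> norm_le (opadj T) c.
Proof.
move=> c0 hT y; set z := opmx_act (opadj T) y.
have [z0|zN0] := eqVneq (dsum_norm z) 0; first by rewrite z0 mulr_ge0 // dsum_norm_ge0.
have z_gt0 : 0 < dsum_norm z by rewrite lt_def zN0 dsum_norm_ge0.
have : dsum_norm z ^+ 2 <= dsum_norm (opmx_act T z) * dsum_norm y.
  by apply: sq_dsum_norm_le; rewrite dsum_inner_adj.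
move=> /le_trans -/(_ (c * dsum_norm z * dsum_norm y)).
rewrite ler_wpM2r ?dsum_norm_ge0 // => /(_ isT).
by rewrite expr2 mulrAC ler_pM2r.
Qed.

Lemma norm_le_isometry T : opadj T *m T = 1%:M -> norm_le T 1.
Proof.
move=> TT x; rewrite mul1r -(@ler_pXn2r _ 2) ?nnegrE ?dsum_norm_ge0 // expr2 -expr2.
rewrite [leRHS]expr2; apply: sq_dsum_norm_le.
by rewrite dsum_inner_adj -opmx_act_mul TT opmx_act1.
Qed.

(** The square of the norm of T is the spectral radius of P = T* T.  As P is a
    conjugate of Y, the powers of P grow at most like a b c^m, while
    Cauchy-Schwarz, |P^m x|^2 = <P^2m x, x> <= |P^2m x| |x|, bounds the powers of
    |T x|^2 by those of P along m = 2^j. *)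
Lemma norm_le_similar T (k k' Y : 'M[A]_n) a b c : k' *m k = 1%:M ->
  opadj T *m T = k *m Y *m k' -> 0 <= a -> 0 <= c ->
  norm_le k a -> norm_le k' b -> norm_le Y c -> norm_le T (Num.sqrt c).
Proof.
move=> k'k PE a0 c0 hk hk' hY x; set P := opadj T *m T in PE.
have P_adj m : opadj (P ^+ m) = P ^+ m.
  elim: m => [|m IH].
    apply/matrixP => i j; rewrite !mxE eq_sym.
    by case: eqP; rewrite ?opstar1 ?opstar0.
  rewrite exprSr -mulmxE opadjM IH /P opadjM opadjK. by rewrite !mulmxE -exprS exprSr.
have Pk m : P ^+ m = k *m Y ^+ m *m k' \/ m = 0%N.
  case: m => [|m]; [by right|left].
  elim: m => [|m IH]; first by rewrite !expr1.
  rewrite exprS IH {1}PE -mulmxE !mulmxA -[k *m Y *m k' *m k]mulmxA k'k mulmx1.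
  by rewrite -[k *m Y *m _]mulmxA mulmxE -exprS.
have hYm m : norm_le (Y ^+ m) (c ^+ m).
  elim: m => [|m IH]; first by move=> y; rewrite opmx_act1 expr0 mul1r.
  by rewrite !exprS -mulmxE; exact: norm_le_mul.
have hP j : dsum_norm (opmx_act (P ^+ (2 ^ j)) x) <= a * b * c ^+ (2 ^ j) * dsum_norm x.
  have [->|/eqP] := Pk (2 ^ j)%N; last by rewrite expn_eq0.
  have h1 := norm_le_mul a0 hk (hYm (2 ^ j)%N).
  have h2 := norm_le_mul (mulr_ge0 a0 (exprn_ge0 _ c0)) h1 hk'.
  by have := h2 x; rewrite [a * b * _]mulrAC.
have [x0|xN0] := eqVneq (dsum_norm x) 0.
  have z0 : opmx_act T x = 0.
    apply: dsum_inner_eq0; rewrite dsum_inner_adj -opmx_act_mul (dsum_norm_eq0 x0).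
    rewrite /dsum_inner big1 // => i _.
    exact: inner0l.
  by rewrite (_ : opmx_act T x = x) ?x0 ?mulr0 // z0 (dsum_norm_eq0 x0).
have x_gt0 : 0 < dsum_norm x by rewrite lt_def xN0 dsum_norm_ge0.
pose N := dsum_norm x; pose u := dsum_norm (opmx_act T x) ^+ 2.
have u0 : 0 <= u by exact: sqr_ge0.
have N20 : 0 <= N ^+ 2 by exact: sqr_ge0.
have key j : u ^+ (2 ^ j) * N <= dsum_norm (opmx_act (P ^+ (2 ^ j)) x) * (N ^+ 2) ^+ (2 ^ j).
  elim: j => [|j IH].
    rewrite expn0 !expr1 expr2 mulrA ler_pM2r // mulrC.
    by apply: sq_dsum_norm_le; rewrite dsum_inner_adj -opmx_act_mul.
  rewrite -(ler_pM2r x_gt0) expnSr !exprM -mulrA -[N * _]expr2 -exprMn.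
  apply: (@le_trans _ _ ((dsum_norm (opmx_act (P ^+ (2 ^ j)) x) * (N ^+ 2) ^+ (2 ^ j)) ^+ 2)).
    by rewrite ler_pXn2r ?nnegrE ?mulr_ge0 ?dsum_norm_ge0 ?exprn_ge0 // dsum_norm_ge0.
  rewrite exprMn [leRHS]mulrAC; apply: ler_wpM2r; first by do 2 apply: exprn_ge0.
  by apply: sq_dsum_norm_le; rewrite expr2 -mulmxE opmx_act_mul [RHS]dsum_inner_adj P_adj.
suff : u <= c * N ^+ 2.
  move=> h; rewrite -(@ler_pXn2r _ 2) ?nnegrE ?mulr_ge0 ?sqrtr_ge0 ?dsum_norm_ge0 //.
  by rewrite exprMn (sqr_sqrtr c0).
apply: (@le_of_pow2_le _ _ _ (a * b)) => //; first by rewrite mulr_ge0.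
move=> j; rewrite -(ler_pM2r x_gt0); apply: (le_trans (key j)).
rewrite [(c * _) ^+ _]exprMn mulrA [leRHS]mulrAC; apply: ler_wpM2r; last exact: hP.
by rewrite exprn_ge0.
Qed.

End DirectSum.

(** * Interpolation *)

Section Interpolation.
Context {R : realType} {H : hilbertType R} {n : nat}.
Local Notation A := (adjop H).
Local Notation C := R[i].

Lemma norm_leW (T : 'M[A]_n) c d : c <= d -> norm_le T c -> norm_le T d.
Proof.
by move=> cd hT x; rewrite (le_trans (hT x)) // ler_wpM2r // dsum_norm_ge0.
Qed.

(** D is a one-parameter group of hermitian matrices, uniformly bounded for
    parameters in [-1, 1]; it stands for t |-> Q^t. *)
Section Flow.
Context (D : R -> 'M[C]_n) (V : 'M[A]_n) (q : R).
Hypothesis DD : forall s t, D s *m D t = D (s + t).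
Hypothesis D0 : D 0 = 1%:M.
Hypothesis Dh : forall t, (D t) ^t* = D t.
Hypothesis D_norm : forall t, `|t| <= 1 -> norm_le (amp (D t) : 'M[A]_n) q.
Hypothesis q_ge0 : 0 <= q.

Definition twist (t : R) : 'M[A]_n := amp (D t) *m V *m amp (D (- t)).

(** With T = twist, T_m* T_m = D_d (T_(m+d)* T_(m-d)) D_(-d). *)
Lemma twist_midpoint m d c c' : `|d| <= 1 -> 0 <= c -> 0 <= c' ->
  norm_le (twist (m + d)) c -> norm_le (twist (m - d)) c' ->
  norm_le (twist m) (Num.sqrt (c * c')).
Proof.
move=> d1 c0 c'0 h h'.
apply: (@norm_le_similar _ _ _ _ (amp (D d)) (amp (D (- d)))
  (opadj (twist (m + d)) *m twist (m - d)) q q).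
- by rewrite -ampM DD addNr D0 amp1.
- rewrite /twist !opadjM !opadj_amp !Dh.
  have e s t (X : 'M[A]_n) : amp (D s) *m (amp (D t) *m X) = amp (D (s + t)) *m X.
    by rewrite mulmxA -ampM DD.
  rewrite -!mulmxA !e -ampM DD.
  have e1 : d - (m + d) = - m by ring.
  have e2 : m + d + (m - d) = m + m by ring.
  have e3 : - (m - d) - d = - m by ring.
  by rewrite e1 e2 e3.
- exact: q_ge0.
- by rewrite mulr_ge0.
- exact: D_norm.
- by apply: D_norm; rewrite normrN.
- by apply: norm_le_mul => //; exact: norm_le_adj.
Qed.

Hypothesis n_gt0 : (0 < n)%N.
Hypothesis V_norm : norm_le V n%:R.
Hypothesis V_isom : norm_le (twist (1 / 2)) 1.

Let n1 : 1 <= n%:R :> R. Proof. by rewrite ler1n. Qed.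
Let n0 : 0 < n%:R :> R. Proof. by rewrite ltr0n. Qed.

Lemma twist0 : twist 0 = V.
Proof. by rewrite /twist oppr0 D0 amp1 mul1mx mulmx1. Qed.

Lemma twist_crude t : `|t| <= 1 -> norm_le (twist t) (q * n%:R * q).
Proof.
move=> t1; apply: norm_le_mul; first by rewrite mulr_ge0 // ltW.
- by apply: norm_le_mul => //; exact: D_norm.
- by apply: D_norm; rewrite normrN.
Qed.

(** For theta below 1/2 the interval [0, 2 theta] has midpoint theta and the sharp
    bound n at its left end; above 1/2 the interval [2 theta - 1, 1] has the sharp
    bound 1 at its right end.  Either way the constant K enters only once in the
    geometric mean. *)
Lemma twist_improve (K : R) : 0 <= K ->
  (forall theta, 0 <= theta <= 1 -> norm_le (twist (theta / 2)) (K * n%:R `^ (1 - theta))) ->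
  forall theta, 0 <= theta <= 1 ->
    norm_le (twist (theta / 2)) (Num.sqrt K * n%:R `^ (1 - theta)).
Proof.
move=> K0 h theta /andP[t0 t1].
have nD s t : n%:R `^ s * n%:R `^ t = n%:R `^ (s + t) :> R.
  by rewrite powRD // (gt_eqF n0) implybT.
have sqE : Num.sqrt K * n%:R `^ (1 - theta) = Num.sqrt (K * n%:R `^ (2 - 2 * theta)).
  rewrite sqrtrM // (_ : 2 - 2 * theta = (1 - theta) + (1 - theta)); last by ring.
  by rewrite -(nD (1 - theta) (1 - theta)) -expr2 sqrtr_sqr ger0_norm // powR_ge0.
rewrite sqE.
have [th|th] := leP theta (1 / 2).
  have hh : norm_le (twist (2 * theta / 2)) (K * n%:R `^ (1 - 2 * theta)).
    by apply: h; apply/andP; split; lra.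
  have -> : K * n%:R `^ (2 - 2 * theta) = (K * n%:R `^ (1 - 2 * theta)) * n%:R.
    rewrite -mulrA -[X in _ * (_ * X)]powRr1 ?ltW // nD; congr (_ * _ `^ _); ring.
  apply: (@twist_midpoint _ (theta / 2)).
  - by rewrite ger0_norm; lra.
  - by rewrite mulr_ge0 // powR_ge0.
  - exact: ltW.
  - by rewrite (_ : theta / 2 + theta / 2 = 2 * theta / 2) //; field.
  - by rewrite subrr twist0.
have hh : norm_le (twist ((2 * theta - 1) / 2)) (K * n%:R `^ (1 - (2 * theta - 1))).
  by apply: h; apply/andP; split; lra.
rewrite -[X in Num.sqrt X]mul1r.
apply: (@twist_midpoint _ ((1 - theta) / 2)).
- by rewrite ger0_norm; lra.
- exact: ler01.
- by rewrite mulr_ge0 // powR_ge0.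
- by rewrite (_ : theta / 2 + (1 - theta) / 2 = 1 / 2) //; field.
- rewrite (_ : theta / 2 - (1 - theta) / 2 = (2 * theta - 1) / 2); last by field.
  by rewrite (_ : 2 - 2 * theta = 1 - (2 * theta - 1)) //; ring.
Qed.

(** A crude uniform bound K is improved to K^(1/2^j) for every j. *)
Lemma twist_norm theta : 0 <= theta <= 1 ->
  norm_le (twist (theta / 2)) (n%:R `^ (1 - theta)).
Proof.
pose K := q * n%:R * q; have K0 : 0 <= K by rewrite !mulr_ge0 // ltW.
pose Kk j := iter j Num.sqrt K.
have Kk0 j : 0 <= Kk j by case: j => [//|j]; exact: sqrtr_ge0.
have KkE j : Kk j ^+ (2 ^ j) = K.
  elim: j => [|j IH]; first by rewrite expn0 expr1.
  by rewrite expnS exprM /= sqr_sqrtr // IH.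
have h j t : 0 <= t <= 1 -> norm_le (twist (t / 2)) (Kk j * n%:R `^ (1 - t)).
  elim: j t => [|j IH] t t01; last exact: twist_improve t01.
  apply: (@norm_leW _ K).
    by rewrite ler_peMr // -[leLHS](powRr0 n%:R) ler_powR // subr_ge0; case/andP: t01.
  by apply: twist_crude; case/andP: t01 => t0 t1; rewrite ger0_norm; lra.
move=> t01 x; apply: (@le_of_pow2_le _ _ _ K).
- exact: dsum_norm_ge0.
- by rewrite mulr_ge0 ?powR_ge0 // dsum_norm_ge0.
move=> j; rewrite -(KkE j) -exprMn ler_pXn2r ?nnegrE ?dsum_norm_ge0 ?expn_gt0 //.
  by rewrite mulrA; exact: h.
by rewrite !mulr_ge0 ?powR_ge0 // dsum_norm_ge0.
Qed.

End Flow.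
End Interpolation.

(** * The two endpoints *)

Section Bounds.
Context {R : realType} {H : hilbertType R} {n : nat}.
Local Notation A := (adjop H).
Local Notation C := R[i].

Lemma norm_le_diag (d : 'rV[C]_n) (a : R) : 0 <= a ->
  (forall i, `|d 0 i| <= a%:C) -> norm_le (amp (diag_mx d) : 'M[A]_n) a.
Proof.
move=> a0 da x.
rewrite -(@ler_pXn2r _ 2) ?nnegrE ?mulr_ge0 ?dsum_norm_ge0 //.
rewrite -lecR -dsum_inner_norm [leRHS](_ : _ = a%:C ^+ 2 * dsum_inner x x); last first.
  by rewrite dsum_inner_norm exprMn -rmorphXn -rmorphM.
rewrite /dsum_inner mulr_sumr; apply: ler_sum => i _.
have -> : opmx_act (amp (diag_mx d)) x i = d 0 i *: x i.
  rewrite /opmx_act (bigD1 i) //= big1 => [|j ji]; rewrite !mxE.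
    by rewrite eqxx mulr1n addr0.
  by rewrite eq_sym (negPf ji) mulr0n scale0r.
rewrite !inner_norm normrZ exprMn ler_wpM2r ?exprn_ge0 //.
by rewrite ler_pXn2r ?nnegrE ?normr_ge0 ?ler0c.
Qed.

Lemma sqr_sum_le (a : 'I_n -> R) : (\sum_i a i) ^+ 2 <= n%:R * \sum_i a i ^+ 2.
Proof.
have -> : n%:R * \sum_i a i ^+ 2 = \sum_i \sum_j (a i ^+ 2 + a j ^+ 2) / 2.
  transitivity (\sum_i (n%:R * a i ^+ 2 + \sum_j a j ^+ 2) / 2); last first.
    apply: eq_bigr => i _; rewrite -[RHS]mulr_suml big_split /= sumr_const card_ord.
    by rewrite mulr_natl.
  rewrite -[RHS]mulr_suml big_split /= -mulr_sumr sumr_const card_ord -mulr_natl.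
  by field.
rewrite expr2 mulr_suml; apply: ler_sum => i _; rewrite mulr_sumr; apply: ler_sum => j _.
by have := sqr_ge0 (a i - a j); nra.
Qed.

(** The relation U U* = 1 makes the adjoint of each entry of U a contraction, and
    an n by n matrix of contractions has norm at most n. *)
Lemma norm_le_conj (U : 'M[A]_n) : U *m opadj U = 1%:M -> norm_le (opconj U) n%:R.
Proof.
move=> UU; pose r (z : H) : R := complex.Re `|z|.
have rE (z : H) : `|z| = (r z)%:C := norm_ReE z.
have r0 (z : H) : 0 <= r z by rewrite -ler0c -rE.
have contr i j y : r (opconj U i j y) <= r y.
  rewrite -lecR -!rE -(@ler_pXn2r _ 2) ?nnegrE // -!inner_norm.
  have -> : inner y y = \sum_k inner (opconj U i k y) (opconj U i k y).
    have /matrixP/(_ i i) := UU; rewrite !mxE eqxx => /(congr1 (fun T : A => inner (T y) y)).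
    rewrite /= opval_sum fct_sumE inner_suml => <-; apply: eq_bigr => k _.
    by rewrite !mxE opvalM /= -[adjoint (U i k)]/(opval (opstar (U i k))) opstarP.
  by rewrite (bigD1 j) //= lerDl sumr_ge0 // => k _; exact: inner_ge0.
move=> x; rewrite -(@ler_pXn2r _ 2) ?nnegrE ?mulr_ge0 ?dsum_norm_ge0 // exprMn.
have sq y : dsum_norm y ^+ 2 = \sum_i r (y i) ^+ 2.
  by rewrite sqr_sqrtr // sumr_ge0 // => i _; exact: sqr_ge0.
rewrite !sq [n%:R ^+ 2]expr2 -mulrA.
apply: (@le_trans _ _ (\sum_(i < n) n%:R * \sum_j r (x j) ^+ 2)); last first.
  by rewrite sumr_const card_ord -[leLHS]mulr_natl.
apply: ler_sum => i _; apply: le_trans (sqr_sum_le _).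
rewrite ler_pXn2r ?nnegrE ?sumr_ge0 //.
rewrite -lecR -rE /opmx_act (le_trans (ler_norm_sum _ _ _)) // rmorph_sum ler_sum // => j _.
by rewrite rE lecR.
Qed.

Lemma opmx_norm_le (T : 'M[A]_n) (c : R) : 0 <= c -> norm_le T c ->
  opmx_norm (opmx T) <= c.
Proof.
move=> c0 hT; apply: ge_sup => [|_ [x /= x1 <-]].
  exists (dsum_norm (fun i => \sum_j opmx T i j 0)), (fun=> 0) => //=.
  rewrite /dsum_norm big1 ?sqrtr0 // => i _.
  by rewrite normr0 expr0n.
have -> : (fun i => \sum_j opmx T i j (x j)) = opmx_act T x.
  by apply/funext => i; apply: eq_bigr => j _; rewrite mxE.
by rewrite (le_trans (hT x)) // ler_piMr.
Qed.

End Bounds.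

Section DiagPower.
Context {R : realType} {n : nat} (Q : 'M[R[i]]_n).
Hypothesis Q_gt0 : forall i, 0 < complex.Re (Q i i).

Lemma diag_powerD s t : diag_power Q s *m diag_power Q t = diag_power Q (s + t).
Proof.
rewrite mulmx_diag; congr diag_mx; apply/rowP => i; rewrite !mxE -rmorphM.
by rewrite powRD // (gt_eqF (Q_gt0 i)) implybT.
Qed.

Lemma diag_power0 : diag_power Q 0 = 1%:M.
Proof.
rewrite -diag_const_mx; congr diag_mx; apply/rowP => i.
by rewrite !mxE powRr0.
Qed.

Lemma diag_power_adj t : (diag_power Q t) ^t* = diag_power Q t.
Proof.
rewrite tr_diag_mx map_diag_mx; congr diag_mx; apply/rowP => i; rewrite !mxE.
exact: conjc_real.
Qed.

(** For -1 <= t <= 1, q^t is at most the larger of q and 1/q; the sum over all i is a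
    bound common to all entries and all t. *)
Lemma diag_power_norm (H : hilbertType R) t : `|t| <= 1 ->
  norm_le (amp (diag_power Q t) : 'M[adjop H]_n)
    (\sum_i (complex.Re (Q i i) + (complex.Re (Q i i))^-1)).
Proof.
set q := fun i => complex.Re (Q i i); rewrite ler_norml => /andP[t1 t2].
have q0 i : 0 <= q i + (q i)^-1 by rewrite addr_ge0 // ?invr_ge0 ltW // Q_gt0.
apply: norm_le_diag => [|i]; first by apply: sumr_ge0 => i _; exact: q0.
rewrite !mxE ger0_norm ?lecR ?powR_ge0 //.
apply: (@le_trans _ _ (q i + (q i)^-1)); last first.
  by rewrite (bigD1 i) //= lerDl sumr_ge0 // => j _; exact: q0.
have qi := Q_gt0 i; have [q1|q1] := leP 1 (q i).
  apply: (@le_trans _ _ (q i)); last by rewrite lerDl invr_ge0 ltW.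
  by rewrite -[leRHS](powRr1 (ltW qi)) ler_powR.
apply: (@le_trans _ _ (q i)^-1); last by rewrite lerDr ltW.
have -> : (q i)^-1 = q i `^ (-1) by rewrite powR_inv1 // ltW.
by apply: ger_powR => //; rewrite qi ltW.
Qed.

End DiagPower.

Lemma positive_diag (R : realType) n (Q : 'M[R[i]]_n) : positive_mx Q ->
  Q \in unitmx -> is_diag_mx Q ->
  (forall i, 0 < complex.Re (Q i i)) /\ Q = diag_power Q 1.
Proof.
move=> Qpos Qu /is_diag_mxP Qd.
have Q0 i : 0 <= Q i i.
  have := Qpos (delta_mx i 0); rewrite trmx_delta map_delta_mx -rowE -colE.
  by rewrite !mxE.
have Qn i : Q i i != 0.
  have /matrixP/(_ i i) := mulVmx Qu; rewrite !mxE eqxx (bigD1 i) //= big1 ?addr0.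
    by move=> e; apply/eqP => z; move/eqP: e; rewrite z mulr0 eq_sym oner_eq0.
  by move=> k ki; rewrite (Qd k i) ?mulr0.
have QE i : Q i i = (complex.Re (Q i i))%:C by rewrite RRe_real // ger0_real.
have Qgt i : 0 < complex.Re (Q i i) by rewrite -ltcR -QE lt_def Qn Q0.
split=> //; apply/matrixP => i j; rewrite !mxE powRr1 ?ltW // -QE.
by case: eqVneq => [->|ij]; rewrite ?mulr1n // mulr0n Qd.
Qed.

Theorem proposition3p6 (R : realType) (G : compactQuantumGroup R)
    (S : (qgH G -> qgH G) -> (qgH G -> qgH G)) (hS : antipode S)
    (n : nat) (u : 'M[qgH G -> qgH G]_n) (hu : irreducible_unitary u)
    (Q : 'M[R[i]]_n) (hQ : modular_mx S u Q) (hQdiag : is_diag_mx Q)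
    (theta : R) (htheta : 0 <= theta <= 1) :
  representation (twisted_contragredient u Q theta) /\
  opmx_norm (twisted_contragredient u Q theta) <= n%:R `^ (1 - theta).
Proof.
have [[[uL _] _ _] [n0 _]] := hu.
have [U UE] := opmx_lift (fun i j => Linf_adjointable (uL i j)).
move: hu hQ; rewrite -UE => hu hQ.
have [/unitary_repP[rU [_ UU]] _] := hu.
have [Qpos Qu _ _] := hQ.
have [Q0 Q1] := positive_diag Qpos Qu hQdiag.
have VQV := modular_mx_invariant hS hu hQ hQdiag.
have DD := diag_powerD Q0; have D0 := diag_power0 Q; have Dh := diag_power_adj Q.
have -> : twisted_contragredient (opmx U) Q theta =
    opmx (twist (diag_power Q) (opconj U) (theta / 2)).
  rewrite /twisted_contragredient /contragredient -opmx_conj -!opmx_ampE -!opmxM.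
  by rewrite mulmxA.
split.
  apply/repmxP/repmx_conjugate; last exact: repmx_contragredient.
  by rewrite DD addNr D0.
apply: opmx_norm_le; first exact: powR_ge0.
apply: (twist_norm DD D0 Dh (diag_power_norm Q0 (H := qgH G))) => //.
- by apply: sumr_ge0 => i _; rewrite addr_ge0 // ?invr_ge0 ltW.
- exact: norm_le_conj.
apply: norm_le_isometry; rewrite /twist !opadjM !opadj_amp !Dh.
have e s t (X : 'M[adjop (qgH G)]_n) : amp (diag_power Q s) *m (amp (diag_power Q t) *m X) =
    amp (diag_power Q (s + t)) *m X by rewrite mulmxA -ampM DD.
have V1 X : opadj (opconj U) *m (amp (diag_power Q 1) *m (opconj U *m X)) =
    amp (diag_power Q 1) *m X by rewrite !mulmxA -Q1 VQV.
rewrite -!mulmxA !e (_ : 1 / 2 + 1 / 2 = 1); last by field.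
by rewrite V1 e -ampM DD (_ : - (1 / 2) + 1 - 1 / 2 = 0) ?D0 ?amp1 //; field.
Qed.
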